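(* Let $f=(f_e^+,f_e^-)_{e\in E}$ be a restricted Nash flow over time on $[0,\phi)$ in a time-varying network with right-constant capacities, speed limits and network inflow rate, and let $\alpha>0$ be feasible (with respect to a thin flow with resetting chosen for particle $\phi$). Then the $\alpha$-extension of $f$ is a restricted Nash flow over time on $[0,\phi+\alpha)$.
   Context: **Network.** $G=(V,E)$ is a finite directed graph with source $s$ and sink $t$, $s\neq t$, such that every node is reachable from $s$. Each arc $e$ has a capacity $\nu_e:[0,\infty)\to(0,\infty)$ and a speed limit $\lambda_e:[0,\infty)\to(0,\infty)$; there is a network inflow rate $r:[0,\infty)\to(0,\infty)$. All these functions are locally integrable, and $\int_0^\theta\nu_e$, $\int_0^\theta\lambda_e$, $\int_0^\theta r$ tend to $\infty$ as $\theta\to\infty$. A function $g$ on $[0,\infty)$ is *right-constant* if for every $\theta\ge0$ there is $\epsilon>0$ such that $g$ is constant on $[\theta,\theta+\epsilon)$. Throughout, all $\nu_e$, $\lambda_e$ and $r$ are right-constant. Write $\delta_v^+$ and $\delta_v^-$ for the sets of arcs leaving and entering $v$. **Transit times and speed ratios.** $\tau_e(\theta):=\min\{\tau\ge0 : \int_\theta^{\theta+\tau}\lambda_e(\xi)\,d\xi=1\}$ and $\gamma_e(\theta):=\lambda_e(\theta)/\lambda_e(\theta+\tau_e(\theta))$. **Flows over time.** A flow over time is a family $f=(f_e^+,f_e^-)_{e\in E}$ of locally integrable, bounded, nonnegative functions on $[0,\infty)$, with $F_e^\pm(\theta):=\int_0^\theta f_e^\pm(\xi)\,d\xi$, satisfying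 $F_e^-(\theta+\tau_e(\theta))\le F_e^+(\theta)$ for all $\theta\ge 0$ and all $e$, and for almost all $\theta$: $\sum_{e\in\delta_v^+}f_e^+(\theta)-\sum_{e\in\delta_v^-}f_e^-(\theta)$ equals $0$ for $v\in V\setminus\{s,t\}$ and equals $r(\theta)$ for $v=s$. The queue size is $z_e(\theta+\tau_e(\theta)):=F_e^+(\theta)-F_e^-(\theta+\tau_e(\theta))$. It is *feasible* if for all $e$ and almost all $\theta$: $f_e^-(\theta+\tau_e(\theta))=\nu_e(\theta+\tau_e(\theta))$ if $z_e(\theta+\tau_e(\theta))>0$, and $f_e^-(\theta+\tau_e(\theta))=\min\{f_e^+(\theta)/\gamma_e(\theta),\ \nu_e(\theta+\tau_e(\theta))\}$ otherwise; and $f_e^-(\theta)=0$ for almost all $\theta<\tau_e(0)$. **Waiting, exit and earliest arrival times.** $q_e(\theta):=\min\{q\ge0:\int_{\theta+\tau_e(\theta)}^{\theta+\tau_e(\theta)+q}\nu_e(\xi)\,d\xi=z_e(\theta+\tau_e(\theta))\}$, $T_e(\theta):=\theta+\tau_e(\theta)+q_e(\theta)$. For particles $\varphi\in[0,\infty)$: $\ell_s(\varphi)=\min\{\theta\ge0:\int_0^\theta r(\xi)\,d\xi=\varphi\}$ and $\ell_v(\varphi)=\min_{e=uv\in\delta_v^-}T_e(\ell_u(\varphi))$ for $v\ne s$. An arc $e=uv$ is active for $\varphi$ if $\ell_v(\varphi)=T_e(\ell_u(\varphi))$; $E'_\varphi$ is the set of active arcs, $G'_\varphi=(V,E'_\varphi)$,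 and $E^*_\varphi:=\{e=uv\in E: q_e(\ell_u(\varphi))>0\}$. **Nash flow over time.** A feasible flow over time such that for all $e=uv\in E$ and almost all $\theta\ge0$: $f_e^+(\theta)>0\Rightarrow\theta\in\ell_u(\Phi_e)$, where $\Phi_e:=\{\varphi\ge0: e\in E'_\varphi\}$. **Restricted Nash flow over time** on $[0,\phi]$ (equivalently on $[0,\phi)$): a Nash flow over time in which only the particles in $[0,\phi]$ are considered. That is, $f$ is a feasible flow over time for the network inflow rate truncated to $r(\theta)$ for $\theta<\ell_s(\phi)$ and $0$ for $\theta\ge\ell_s(\phi)$ (with $\ell_s$ still defined by the original $r$), and the Nash condition holds with $\Phi_e$ replaced by $\Phi_e\cap[0,\phi]$. **Thin flow with resetting.** Let $G'=(V,E')$ be acyclic with every node reachable from $s$, with numbers $\nu_e>0$, $\gamma_e>0$ ($e\in E'$), $r>0$, and $E^*\subseteq E'$. A static $s$-$t$-flow $(x'_e)_{e\in E'}$ of value $1$ (nonnegative, conserved at all $v\neq s,t$, net outflow $1$ at $s$) together with node labels $(\ell'_v)_{v\in V}$ is a thin flow with resetting on $E^*$ if $\ell'_s=1/r$; $\ell'_v=\min_{e=uv\in E'}\rho_e(\ell'_u,x'_e)$ for $v\ne s$; and $\ell'_v=\rho_e(\ell'_u,x'_e)$ for all $e=uv\in E'$ with $x'_e>0$; where $\rho_e(\ell'_u,x'_e):=x'_e/\nu_e$ if $e\in E^*$ and $:=\max\{\gamma_e\ell'_u,x'_e/\nu_e\}$ if $e\in E'\setminus E^*$. **$\alpha$-extension.**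 Given a restricted Nash flow over time $f$ on $[0,\phi]$, take a thin flow $((x'_e),(\ell'_v))$ with resetting on $E^*_\phi$ in $G'_\phi$ with capacities $\nu_e(\ell_v(\phi))$, speed ratios $\gamma_e(\ell_u(\phi))$ (for $e=uv\in E'_\phi$) and inflow rate $r(\ell_s(\phi))$; set $x'_e:=0$ for $e\notin E'_\phi$. With $x_e(\phi):=F_e^+(\ell_u(\phi))=F_e^-(\ell_v(\phi))$, extend for $\xi\in[0,\alpha)$ by $\ell_v(\phi+\xi):=\ell_v(\phi)+\xi\ell'_v$ and $x_e(\phi+\xi):=x_e(\phi)+\xi x'_e$, and extend the rates for each $e=uv$ by $f_e^+(\theta):=x'_e/\ell'_u$ for $\theta\in[\ell_u(\phi),\ell_u(\phi)+\alpha\ell'_u)$ and $f_e^-(\theta):=x'_e/\ell'_v$ for $\theta\in[\ell_v(\phi),\ell_v(\phi)+\alpha\ell'_v)$ (these intervals are empty when $\ell'_u=0$, resp. $\ell'_v=0$); the rates keep their values before these intervals and are $0$ after them. The result is the $\alpha$-extension. **Feasible $\alpha$.** $\alpha>0$ is feasible if for all $\xi\in[0,\alpha)$ (with $e=uv$): - $\ell_v(\phi)+\xi\ell'_v-\ell_u(\phi)-\xi\ell'_u>\tau_e(\ell_u(\phi)+\xi\ell'_u)$ for every $e\in E^*_\phi$; - $\ell_v(\phi)+\xi\ell'_v-\ell_u(\phi)-\xi\ell'_u<\tau_e(\ell_u(\phi)+\xi\ell'_u)$ for every $e\in E\setminus E'_\phi$; - $\nu_e(\ell_v(\phi))=\nu_e(\ell_v(\phi)+\xi\ell'_v)$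 for every $e\in E'_\phi$; - $r(\ell_s(\phi))=r(\ell_s(\phi)+\xi\ell'_s)$; - $\gamma_e(\ell_u(\phi))=\gamma_e(\ell_u(\phi)+\xi\ell'_u)$ for every $e\in E'_\phi$. *)

(* Defs.v *)
From mathcomp Require Export all_boot all_order all_algebra.
From mathcomp Require Export all_classical all_reals all_analysis.
Export Order.TTheory GRing.Theory Num.Theory.
Export numFieldNormedType.Exports.

Set Implicit Arguments.
Unset Strict Implicit.
Unset Printing Implicit Defensive.

Local Open Scope classical_set_scope.
Local Open Scope ring_scope.

(* All functions of time or of particles are total functions on R of which only
   the values on [0, +oo[ matter. *)

(* The library's [locally_integrable] is only meant for open domains. *)
Definition loc_integrable (R : realType) (g : R -> R) : Prop :=
  forall b : R, (@lebesgue_measure R).-integrable `[0, b] (EFin \o g).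

Definition integ (R : realType) (g : R -> R) (a b : R) : R :=
  \int[@lebesgue_measure R]_(x in `[a, b]) g x.

Definition right_constant (R : realType) (g : R -> R) : Prop :=
  forall theta : R, 0 <= theta ->
  exists2 eps : R, 0 < eps &
    forall xi : R, theta <= xi < theta + eps -> g xi = g theta.

Definition is_min (R : realType) (A : set R) (m : R) : Prop :=
  A m /\ lbound A m.

Definition rate_function (R : realType) (g : R -> R) : Prop :=
  [/\ forall theta : R, 0 <= theta -> 0 < g theta,
      loc_integrable g,
      integ g 0 theta @[theta --> +oo] --> +oo
    & right_constant g].

(* An arc e = uv has u = tail e and v = head e; parallel arcs are allowed. *)
Record network (R : realType) (V E : finType) := Network {
  tail : E -> V;
  head : E -> V;
  src : V;
  snk : V;
  cap : E -> R -> R;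
  speed : E -> R -> R;
  inflow : R -> R;
  src_neq_snk : src != snk;
  src_reach : forall v : V,
    connect (fun u w => [exists e, (tail e == u) && (head e == w)]) src v;
  capP : forall e, rate_function (cap e);
  speedP : forall e, rate_function (speed e);
  inflowP : rate_function inflow }.

(* f_e^+ and f_e^- *)
Record flow (R : realType) (E : finType) := Flow {
  inrate : E -> R -> R;
  outrate : E -> R -> R }.

Section FlowsOverTime.
Context {R : realType} {V E : finType} (N : network R V E).
Local Notation mu := (@lebesgue_measure R).

(* The infima defining [transit], [waiting] and [ell_src] are minima: the
   integrals involved are continuous, start at 0 and tend to infinity. *)
Definition transit (e : E) (theta : R) : R :=
  inf [set tau : R | 0 <= tau /\ integ (speed N e) theta (theta + tau) = 1].

Definition speed_ratio (e : E) (theta : R) : R :=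
  speed N e theta / speed N e (theta + transit e theta).

Definition flow_over_time (r : R -> R) (f : flow R E) : Prop :=
  [/\ forall e,
        [/\ loc_integrable (inrate f e), loc_integrable (outrate f e),
            [bounded inrate f e theta | theta in `[0, +oo[%classic]
          & [bounded outrate f e theta | theta in `[0, +oo[%classic]],
      forall e (theta : R), 0 <= theta ->
        0 <= inrate f e theta /\ 0 <= outrate f e theta,
      forall e (theta : R), 0 <= theta ->
        integ (outrate f e) 0 (theta + transit e theta)
          <= integ (inrate f e) 0 theta,
      forall v, v != src N -> v != snk N ->
        {ae mu, forall theta : R, 0 <= theta ->
          \sum_(e | tail N e == v) inrate f e theta
            - \sum_(e | head N e == v) outrate f e theta = 0}
    & {ae mu, forall theta : R, 0 <= theta ->
          \sum_(e | tail N e == src N) inrate f e theta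
            - \sum_(e | head N e == src N) outrate f e theta = r theta}].

(* [queue f e theta] is the queue size z_e (theta + tau_e theta), indexed by the
   time theta at which the arc is entered. *)
Definition queue (f : flow R E) (e : E) (theta : R) : R :=
  integ (inrate f e) 0 theta
    - integ (outrate f e) 0 (theta + transit e theta).

Definition feasible_flow (r : R -> R) (f : flow R E) : Prop :=
  [/\ flow_over_time r f,
      forall e, {ae mu, forall theta : R, 0 <= theta ->
        outrate f e (theta + transit e theta) =
          if 0 < queue f e theta then cap N e (theta + transit e theta)
          else Num.min (inrate f e theta / speed_ratio e theta)
                       (cap N e (theta + transit e theta))}
    & forall e, {ae mu, forall theta : R, 0 <= theta < transit e 0 ->
        outrate f e theta = 0}].

Definition waiting (f : flow R E) (e : E) (theta : R) : R :=
  inf [set q : R | 0 <= q /\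
    integ (cap N e) (theta + transit e theta) (theta + transit e theta + q)
      = queue f e theta].

Definition exit_time (f : flow R E) (e : E) (theta : R) : R :=
  theta + transit e theta + waiting f e theta.

Definition ell_src (phi : R) : R :=
  inf [set theta : R | 0 <= theta /\ integ (inflow N) 0 theta = phi].

(* [l v phi] is the earliest arrival time of particle phi at v. Labels are
   points in time, hence nonnegative; as transit times are positive there, the
   equations determine [l] on nonnegative particles. *)
Definition earliest_arrival (f : flow R E) (l : V -> R -> R) : Prop :=
  forall phi : R, 0 <= phi ->
  [/\ forall v, 0 <= l v phi,
      l (src N) phi = ell_src phi
    & forall v, v != src N ->
        is_min [set exit_time f e (l (tail N e) phi) | e in
                 [set e | head N e = v]] (l v phi)].

Definition active_arcs (f : flow R E) (l : V -> R -> R) (phi : R) : {set E} :=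
  [set e | l (head N e) phi == exit_time f e (l (tail N e) phi)]%SET.

Definition resetting_arcs (f : flow R E) (l : V -> R -> R) (phi : R) :
    {set E} :=
  [set e | 0 < waiting f e (l (tail N e) phi)]%SET.

Definition truncated_inflow (phi theta : R) : R :=
  if theta < ell_src phi then inflow N theta else 0.

(* Particles in [0, phi]; including phi itself or not only changes the set
   below by one point in time. *)
Definition restricted_nash (f : flow R E) (phi : R) : Prop :=
  feasible_flow (truncated_inflow phi) f /\
  exists2 l : V -> R -> R, earliest_arrival f l &
    forall e, {ae mu, forall theta : R, 0 <= theta -> 0 < inrate f e theta ->
      [set l (tail N e) psi | psi in
        [set psi : R | 0 <= psi <= phi /\ e \in active_arcs f l psi]] theta}.

Section ThinFlow.
Variables (E' Estar : {set E}) (nu gamma : E -> R) (r : R).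

Definition rho (l' : V -> R) (x' : E -> R) (e : E) : R :=
  if e \in Estar then x' e / nu e
  else Num.max (gamma e * l' (tail N e)) (x' e / nu e).

(* Only the values of [x'] on [E'] matter. That [E'] is acyclic and spans V from
   the source and that [Estar] lies in [E'] is not required here: it holds for
   the active and resetting arcs of a restricted Nash flow. *)
Definition thin_flow (x' : E -> R) (l' : V -> R) : Prop :=
  [/\ [/\ forall e, e \in E' -> 0 <= x' e,
          forall v, v != src N -> v != snk N ->
            \sum_(e in E' | tail N e == v) x' e
              - \sum_(e in E' | head N e == v) x' e = 0
        & \sum_(e in E' | tail N e == src N) x' e
            - \sum_(e in E' | head N e == src N) x' e = 1],
      l' (src N) = r^-1,
      forall v, v != src N ->
        is_min [set rho l' x' e | e in [set e | e \in E' /\ head N e = v]]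
               (l' v)
    & forall e, e \in E' -> 0 < x' e -> l' (head N e) = rho l' x' e].

End ThinFlow.

Definition particle_thin_flow (f : flow R E) (l : V -> R -> R) (phi : R)
    (x' : E -> R) (l' : V -> R) : Prop :=
  thin_flow (active_arcs f l phi) (resetting_arcs f l phi)
    (fun e => cap N e (l (head N e) phi))
    (fun e => speed_ratio e (l (tail N e) phi))
    (inflow N (l (src N) phi)) x' l'.

(* Keep [g] before [a], take the constant value [c] on [a, b[, and 0 after. *)
Definition extend_rate (g : R -> R) (a b c theta : R) : R :=
  if theta < a then g theta else if theta < b then c else 0.

Definition alpha_extension (f : flow R E) (l : V -> R -> R) (phi : R)
    (x' : E -> R) (l' : V -> R) (alpha : R) : flow R E :=
  let x0 e := if e \in active_arcs f l phi then x' e else 0 in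
  let ext (g : E -> R -> R) (node : E -> V) e :=
    extend_rate (g e) (l (node e) phi) (l (node e) phi + alpha * l' (node e))
      (x0 e / l' (node e)) in
  Flow (ext (inrate f) (tail N)) (ext (outrate f) (head N)).

Definition feasible_alpha (f : flow R E) (l : V -> R -> R) (phi : R)
    (l' : V -> R) (alpha : R) : Prop :=
  0 < alpha /\
  forall xi : R, 0 <= xi < alpha ->
  let lx v := l v phi + xi * l' v in
  [/\ forall e, e \in resetting_arcs f l phi ->
        lx (head N e) - lx (tail N e) > transit e (lx (tail N e)),
      forall e, e \notin active_arcs f l phi ->
        lx (head N e) - lx (tail N e) < transit e (lx (tail N e)),
      forall e, e \in active_arcs f l phi ->
        cap N e (l (head N e) phi) = cap N e (lx (head N e)),
      inflow N (l (src N) phi) = inflow N (lx (src N))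
    & forall e, e \in active_arcs f l phi ->
        speed_ratio e (l (tail N e) phi) = speed_ratio e (lx (tail N e))].

End FlowsOverTime.

(* Main.v *)
Require Import Defs.
From HB Require Import structures.
From mathcomp Require Import ring lra.

(* Waiting in queues preserves the order of particles, and in a restricted Nash
   flow every particle of [0, phi] using an arc e = uv has left it by time
   [l v phi]. Hence all flow of f on e enters before [l u phi], leaves before
   [l v phi], and the alpha-extension just appends one constant piece to each
   rate. On an active arc the thin flow equations leave two possibilities for
   this piece: either the queue stays nonempty and the arc works at capacity, or
   the queue stays empty and particles cross the arc in its transit time. In both
   cases the exit time of the particle entering at [l u phi + xi * l' u] is
   [l v phi + xi * rho e]; on the other arcs feasibility of alpha makes this exit
   time too late. So the labels [l v phi + xi * l' v] satisfy the equations of the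
   earliest arrival times, and all flow in the appended pieces is on active arcs.

   As speed limits are right-constant, the time at which an arc is traversed is a
   locally right-affine function of the time at which it is entered. This lets
   almost everywhere statements be transported along it. *)
Set Implicit Arguments.
Unset Strict Implicit.
Unset Printing Implicit Defensive.

Local Open Scope classical_set_scope.
Local Open Scope ring_scope.

(* Locked, like [queue_time] and [leave] below, because failing unifications
   would otherwise unfold integrals and infima. *)
HB.lock Definition cumul (R : realType) (g : R -> R) (x : R) : R := integ g 0 x.
Canonical cumul_unlockable := Unlockable cumul.unlock.

(** * Integrals of rates and their cumulative functions *)

Section Cumulative.
Context {R : realType}.
Local Notation mu := (@lebesgue_measure R).
Implicit Types (g : R -> R) (a b c x y z : R).

Lemma ae_imp (P Q : R -> Prop) : (forall x, P x -> Q x) ->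
  {ae mu, forall x, P x} -> {ae mu, forall x, Q x}.
Proof. by move=> PQ; apply: negligibleS => x /=; apply: contra_not => /PQ. Qed.

Lemma ae_and (P Q : R -> Prop) : {ae mu, forall x, P x} ->
  {ae mu, forall x, Q x} -> {ae mu, forall x, P x /\ Q x}.
Proof.
move=> aP aQ; apply: (negligibleS _ (negligibleU aP aQ)) => x /=.
by move/not_andP.
Qed.

Lemma ae_neq c : {ae mu, forall x, x <> c}.
Proof.
exists [set c]; split => //=; first exact: lebesgue_measure_set1.
by move=> x /= /contrapT.
Qed.

Definition nonneg_rate g := forall x, 0 <= x -> 0 <= g x.

Lemma loc_integrable_itv g (i : interval R) b : loc_integrable g ->
  [set` i] `<=` `[0, b] -> mu.-integrable [set` i] (EFin \o g).
Proof. by move=> gi ib; apply: integrableS (gi b). Qed.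

Lemma loc_integrable_cst c : loc_integrable (fun=> c : R).
Proof.
move=> b; apply: measurable_bounded_integrable => //=.
  by rewrite lebesgue_measure_itv/=; case: ifP => // _; rewrite -EFinB ltry.
by exists `|c|; split => // y cy x _; exact: ltW.
Qed.

Lemma cumul0 g : cumul g 0 = 0.
Proof. by rewrite unlock /integ set_itv1 Rintegral_set1. Qed.

Lemma integB g a b : loc_integrable g -> 0 <= a -> a <= b ->
  integ g a b = cumul g b - cumul g a.
Proof.
move=> gi a0 ab; rewrite unlock /integ -Rintegral_itv_obnd_cbnd; last first.
  apply: (@loc_integrable_itv _ _ b gi); apply: subset_itvr.
  by rewrite bnd_simp.
rewrite -(@Rintegral_itvB _ g (BLeft 0) (BRight b) a) ?bnd_simp//.
Qed.

Lemma integ_cst c a b : a <= b -> integ (fun=> c) a b = c * (b - a).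
Proof.
move=> ab; rewrite /integ Rintegral_cst//= lebesgue_measure_itv/= lte_fin.
by case: ltgtP ab => //= -> _; rewrite subrr mulr0.
Qed.

(** The comparison is only asked for on [[a, b[], the shape of the pieces appended later; the
    endpoint [b] is a null set. *)
Lemma ae_le_integ g1 g2 a b : loc_integrable g1 -> loc_integrable g2 ->
  nonneg_rate g1 -> nonneg_rate g2 -> 0 <= a ->
  {ae mu, forall x, a <= x < b -> g1 x <= g2 x} ->
  integ g1 a b <= integ g2 a b.
Proof.
move=> i1 i2 p1 p2 a0 g12.
have i g : loc_integrable g -> mu.-integrable `[a, b[ (EFin \o g).
  move=> gi; apply: (@loc_integrable_itv _ _ b gi) => x /=.
  by rewrite !in_itv/= => /andP[ax /ltW ->]; rewrite (le_trans a0 ax).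
rewrite /integ -!Rintegral_itv_bndo_bndc; try exact: i.
have sq x : [set` `[a, b[ ] x -> 0 <= x.
  by rewrite /= in_itv/= => /andP[ax _]; exact: le_trans ax.
rewrite /Rintegral fine_le//; try by apply: integrable_fin_num => //; exact: i.
apply: ae_ge0_le_integral.
- exact: measurable_itv.
- by move=> x /sq x0; rewrite lee_fin p1.
- exact: (measurable_int mu (i _ i1)).
- by move=> x /sq x0; rewrite lee_fin p2.
- exact: (measurable_int mu (i _ i2)).
apply: ae_imp g12 => x /= + xab; rewrite lee_fin; apply.
by move: xab; rewrite /= in_itv.
Qed.

Lemma ae_eq_integ g1 g2 a b : loc_integrable g1 -> loc_integrable g2 ->
  nonneg_rate g1 -> nonneg_rate g2 -> 0 <= a ->
  {ae mu, forall x, a <= x < b -> g1 x = g2 x} ->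
  integ g1 a b = integ g2 a b.
Proof.
move=> i1 i2 p1 p2 a0 g12; apply/eqP; rewrite eq_le.
by apply/andP; split; apply: ae_le_integ => //; apply: ae_imp g12 => x + xab => ->.
Qed.

Lemma ae_cst_integ g c a b : loc_integrable g -> nonneg_rate g -> 0 <= c ->
  0 <= a -> a <= b -> {ae mu, forall x, a <= x < b -> g x = c} ->
  integ g a b = c * (b - a).
Proof.
move=> gi g0 c0 a0 ab gc; rewrite -integ_cst//.
by apply: ae_eq_integ => //; exact: loc_integrable_cst.
Qed.

Lemma integ_ge0 g a b : nonneg_rate g -> 0 <= a -> 0 <= integ g a b.
Proof.
move=> g0 a0; apply: Rintegral_ge0 => x; rewrite /= in_itv/= => /andP[ax _].
by apply: g0; exact: le_trans ax.
Qed.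

Lemma cumul_ge0 g a : nonneg_rate g -> 0 <= cumul g a.
Proof. by move=> g0; rewrite unlock integ_ge0. Qed.

Lemma le_cumul g a b : loc_integrable g -> nonneg_rate g -> 0 <= a -> a <= b ->
  cumul g a <= cumul g b.
Proof. by move=> gi g0 a0 ab; rewrite -subr_ge0 -integB// integ_ge0. Qed.

Lemma cumul_continuous g b : loc_integrable g -> 0 <= b ->
  {within `[0, b], continuous (cumul g)}.
Proof. by move=> gi b0; rewrite unlock; exact: parameterized_integral_continuous. Qed.

End Cumulative.

(** * Almost everywhere statements on the half-line *)

Section AlmostEverywhere.
Context {R : realType}.
Local Notation mu := (@lebesgue_measure R).
Implicit Types (P : R -> Prop) (a b c d x y : R).

(** The infimum of the counterexamples satisfies [P], by [P a] or by the limit hypothesis, so a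
    right neighbourhood of it is free of counterexamples, which is absurd. *)
Lemma real_induction P a b : P a ->
    (forall x, a <= x < b -> P x ->
      exists2 eps : R, 0 < eps & forall y, x <= y < x + eps -> P y) ->
    (forall x, a < x <= b -> (forall y, a <= y < x -> P y) -> P x) ->
  forall x, a <= x <= b -> P x.
Proof.
move=> Pa Pr Pl x0 x0ab; apply: contrapT => nPx0.
pose S := [set x | a <= x <= b /\ ~ P x].
have infS : has_inf S.
  split; first by exists x0.
  by exists a => x [/andP[]].
have Si x : S x -> inf S <= x by apply: ge_inf; case: infS.
have ai : a <= inf S by apply: lb_le_inf; [case: infS|move=> x [/andP[]]].
have ib : inf S <= x0 by apply: Si.
have Plt y : a <= y < inf S -> P y.
  move=> /andP[ay yi]; apply: contrapT => nPy.
  have /Si : S y by split => //; case/andP: x0ab => _ x0b; lra.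
  by lra.
have Pi : P (inf S).
  move: ai; rewrite le_eqVlt => /predU1P[<-//|ai].
  by apply: Pl => //; rewrite ai/=; case/andP: x0ab => _; exact: le_trans.
have [e e0 Pe] : exists2 eps : R, 0 < eps &
    forall y, inf S <= y < inf S + eps -> P y.
  apply: Pr => //; rewrite ai/= lt_neqAle; case/andP: x0ab => _ x0b.
  rewrite (le_trans ib x0b) andbT; apply/eqP => ibE.
  by apply: nPx0; rewrite (_ : x0 = inf S)//; lra.
have [s Ss si] := inf_adherent e0 infS.
by case: (Ss) => _; apply; apply: Pe; rewrite si Si.
Qed.

Lemma ae_bigcup (P : nat -> R -> Prop) :
  (forall n, {ae mu, forall x, P n x}) -> {ae mu, forall x n, P n x}.
Proof.
move=> aP; apply: (negligibleS _ (negligible_bigcup aP)) => x /=.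
by rewrite -existsNP => -[n nP]; exists n.
Qed.

Lemma ae_triv P : (forall x, P x) -> {ae mu, forall x, P x}.
Proof. by move=> aP; apply: (ae_imp _ (ae_neq 0)). Qed.

(* Real induction: the right neighbourhoods need not overlap, so their covering
   of the half-line has to be exhausted from the left. *)
Lemma ae_right_local P a :
    (forall x, a <= x -> exists2 eps : R, 0 < eps &
      {ae mu, forall y, x <= y < x + eps -> P y}) ->
  {ae mu, forall y, a <= y -> P y}.
Proof.
move=> Pr; pose Q x := {ae mu, forall y, a <= y < x -> P y}.
(* The intervals [[a, x - 1/(n+1)[] exhaust [[a, x[], so passing to the limit [x] costs a countable
   union of null sets. *)
have Qlt x : (forall y, a <= y < x -> Q y) -> Q x.
  move=> Qx.
  have /ae_bigcup : forall n : nat,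
      {ae mu, forall y, a <= y < x - n.+1%:R^-1 -> P y}.
    move=> n; have [ax|ax] := leP a (x - n.+1%:R^-1); last first.
      apply: ae_triv => y /andP[ay yx]; have := lt_trans yx ax.
      by rewrite ltNge ay.
    by apply: Qx; rewrite ax/= ltrBlDr ltrDl invr_gt0.
  apply: ae_imp => y yP /andP[ay yx].
  have xy0 : 0 < x - y by rewrite subr_gt0.
  have [n nxy] : exists n : nat, n.+1%:R^-1 < x - y.
    have /ltr_add_invr[n hn] : y < x by [].
    by exists n; rewrite ltrBrDl.
  by apply: (yP n); rewrite ay/= ltrBrDl -ltrBrDr.
have Qn n : Q (a + n%:R).
  apply: (@real_induction Q a (a + n%:R)); last by rewrite lexx lerDl ler0n.
  - by apply: ae_triv => y /andP[ay ya]; exfalso; lra.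
  - move=> x /andP[ax _] Qx; have [e e0 Pe] := Pr x ax.
    exists e => // y /andP[xy ye].
    apply: ae_imp (ae_and Qx Pe) => z [Pz Pz'] /andP[az zy].
    have [xz|zx] := leP x z; last by apply: Pz; rewrite az.
    by apply: Pz'; rewrite xz/=; exact: lt_trans ye.
  - by move=> x _; exact: Qlt.
apply: ae_imp (ae_bigcup Qn) => y Py ay.
apply: (Py (Num.truncn (y - a)).+1); rewrite ay/= -ltrBlDl.
by rewrite truncnS_gt.
Qed.

(** By uniqueness of Lebesgue measure, [mu] is [c] times its image under [x |-> c * x + d], since
    both agree on half-open intervals. Hence preimages of null sets are null. *)
Lemma ae_affine P c d : 0 < c -> {ae mu, forall x, P x} ->
  {ae mu, forall x, P (c * x + d)}.
Proof.
move=> c0 [A [mA A0 PA]].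
pose phi : measurableTypeR R -> measurableTypeR R := fun x => c * x + d.
have mphi : measurable_fun setT phi.
  by apply: measurable_realfun.measurable_funD => //; exact: measurable_realfun.measurable_funM.
pose k : {nonneg R} := NngNum (ltW c0).
have muE X : measurable X -> mu X = (c%:E * mu (phi @^-1` X))%E.
  move=> mX; have -> : (c%:E * mu (phi @^-1` X))%E =
    mscale k (pushforward mu phi) X by [].
  apply: lebesgue_measure_unique mX => //= _ [[u v] _ <-].
  rewrite /mscale /pushforward/=.
  rewrite [X in (_ * X)%E](_ : _ = mu `](u - d) / c, (v - d) / c]); last first.
    congr (mu _); apply/seteqP; split => x; rewrite /phi/= !in_itv/= => /andP[h1 h2].
      by rewrite ltr_pdivrMr// ler_pdivlMr//; lra.
    by move: h1 h2; rewrite ltr_pdivrMr// ler_pdivlMr//; lra.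
  rewrite !lebesgue_measure_itv/= !lte_fin ltr_pM2r ?invr_gt0// ltrBlDr subrK.
  case: ifP => _; last by rewrite mule0.
  by rewrite -!EFinB -EFinM; congr EFin; field; rewrite gt_eqF.
exists (phi @^-1` A); split.
- by rewrite -[phi @^-1` A]setTI; exact: mphi.
- have := muE A mA; rewrite A0 => /esym/eqP; rewrite mule_eq0 => /orP[|/eqP//].
  by rewrite eqe gt_eqF.
- by move=> x /= nP; exact: PA.
Qed.

End AlmostEverywhere.

(** * Cumulative functions of rate functions as increasing bijections of the half-line *)

Section RateFunctions.
Context {R : realType}.
Local Notation mu := (@lebesgue_measure R).
Implicit Types (g : R -> R) (a b c q x y z : R).

Lemma rate_loc_integrable g : rate_function g -> loc_integrable g.
Proof. by case. Qed.

Lemma rate_nonneg g : rate_function g -> nonneg_rate g.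
Proof. by case=> g0 _ _ _ x /g0 /ltW. Qed.

Lemma rate_gt0 g x : rate_function g -> 0 <= x -> 0 < g x.
Proof. by case=> g0 _ _ _; exact: g0. Qed.

(** Right-constancy provides a piece after [a] on which [g] is the positive constant [g a], and this
    piece alone yields a strict gain. *)
Lemma lt_cumul g a b : rate_function g -> 0 <= a -> a < b ->
  cumul g a < cumul g b.
Proof.
move=> rg a0 ab; case: (rg) => g0 gi _ rcg; have [e e0 ge] := rcg a a0.
have [y [ay ye yb]] : exists y, [/\ a < y, y < a + e & y <= b].
  exists (Num.min b (a + e / 2)); split.
  - by rewrite lt_min ab/= ltrDl divr_gt0.
  - by rewrite gt_min; apply/orP; right; lra.
  - by rewrite ge_min lexx.
apply: lt_le_trans (le_cumul gi (rate_nonneg rg) _ yb); last lra.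
rewrite -subr_gt0 -integB//; last exact: ltW.
rewrite (@ae_cst_integ _ g (g a))//.
- by rewrite mulr_gt0 ?subr_gt0// g0.
- exact: rate_nonneg.
- exact: rate_nonneg.
- exact: ltW.
by apply: ae_triv => x /andP[ax xy]; apply: ge; rewrite ax (lt_trans xy).
Qed.

Lemma cumul_leE g a b : rate_function g -> 0 <= a -> 0 <= b ->
  (cumul g a <= cumul g b) = (a <= b).
Proof.
move=> rg a0 b0; apply/idP/idP => [|ab]; last first.
  exact: le_cumul (rate_loc_integrable rg) (rate_nonneg rg) _ _.
by apply: contraTT; rewrite -!ltNge; exact: lt_cumul.
Qed.

Lemma cumul_ltE g a b : rate_function g -> 0 <= a -> 0 <= b ->
  (cumul g a < cumul g b) = (a < b).
Proof. by move=> rg a0 b0; rewrite !ltNge cumul_leE. Qed.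

Lemma cumul_inj g a b : rate_function g -> 0 <= a -> 0 <= b ->
  cumul g a = cumul g b -> a = b.
Proof.
move=> rg a0 b0 gab; apply/eqP; rewrite eq_le.
by rewrite -(cumul_leE rg a0 b0) -(cumul_leE rg b0 a0) gab lexx.
Qed.

Lemma cumul_surj g y : rate_function g -> 0 <= y ->
  exists2 x, 0 <= x & cumul g x = y.
Proof.
move=> rg y0; case: (rg) => _ gi /cvgryPge/(_ y)[M [_ gM]] _.
pose b := Num.max 0 (M + 1).
have b0 : 0 <= b by rewrite le_max lexx.
have yb : y <= cumul g b.
  by rewrite unlock; apply: gM; rewrite lt_max; apply/orP; right; rewrite ltrDl.
have [] := @IVT _ (cumul g) 0 b y b0 (cumul_continuous gi b0).
  by rewrite cumul0 ge_min le_max y0 yb orbT.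
by move=> x; rewrite in_itv/= => /andP[x0 _] gx; exists x.
Qed.

(** Strict monotonicity of [cumul g] makes the set a singleton. Transit times, waiting times and
    source labels are all computed this way. *)
Lemma inf_integ g a q z : rate_function g -> 0 <= a -> 0 <= q ->
  cumul g (a + q) = cumul g a + z ->
  inf [set q : R | 0 <= q /\ integ g a (a + q) = z] = q.
Proof.
move=> rg a0 q0 gq; rewrite [X in inf X](_ : _ = [set q]) ?inf1//.
have gi := rate_loc_integrable rg.
apply/seteqP; split => [p /= [p0]|p ->/=]; last first.
  by rewrite integB ?lerDl// gq; split => //; ring.
rewrite integB ?lerDl// => gp; apply: (@addrI _ a).
by apply: (cumul_inj rg); rewrite ?addr_ge0// gq -gp; ring.
Qed.

(** Continuity, in the form needed where a bound is known only strictly before [x]: in the limit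
    step of a real induction and at a supremum. *)
Lemma cumul_left_limit g x z : loc_integrable g -> 0 < x ->
  (forall y, 0 <= y < x -> cumul g y <= z) -> cumul g x <= z.
Proof.
move=> gi x0 gz.
have /continuous_within_itvP - /(_ x0)[_ _ gx] := cumul_continuous gi (ltW x0).
rewrite -(cvg_lim _ gx)//; apply: limr_le; first by apply/cvg_ex; eexists; exact: gx.
near=> y; apply: gz; apply/andP; split => //.
by near: y; exact: nbhs_left_ge.
Unshelve. all: by end_near. Qed.

End RateFunctions.

Lemma cumul_right_affine (R : realType) (g : R -> R) (x : R) :
  rate_function g -> 0 <= x ->
  exists2 eps : R, 0 < eps & forall h : R, 0 <= h < eps ->
    cumul g (x + h) = cumul g x + g x * h.
Proof.
move=> rg x0; case: (rg) => g0 gi _ rcg; have [e e0 ge] := rcg x x0.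
exists e => // h /andP[h0 he].
rewrite -[LHS](subrKC (cumul g x)) -integB ?lerDl//.
rewrite (@ae_cst_integ _ g (g x) x) ?lerDl//.
- by ring.
- exact: rate_nonneg.
- exact: rate_nonneg.
by apply: ae_triv => y /andP[xy yh]; apply: ge; rewrite xy (lt_trans yh)// ltrD2l.
Qed.

(** * Times at which particles reach the queue of an arc *)

HB.lock Definition queue_time (R : realType) (V E : finType)
  (N : network R V E) (e : E) (t : R) : R := t + transit N e t.
Canonical queue_time_unlockable := Unlockable queue_time.unlock.

Section Transit.
Context {R : realType} {V E : finType} (N : network R V E) (e : E).
Local Notation mu := (@lebesgue_measure R).
Local Notation entry t := (queue_time N e t).
Local Notation lam := (speed N e).
Implicit Types (t x h : R).

Let rlam : rate_function lam. Proof. exact: speedP. Qed.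

Lemma queue_timeE t : entry t = t + transit N e t.
Proof. by rewrite unlock. Qed.

(** Measured by the distance [cumul lam], traversing the arc adds one unit. Order, surjectivity and
    local shape of [entry] follow from this equation by inverting [cumul lam]. *)
Lemma entry_spec t : 0 <= t -> t < entry t /\ cumul lam (entry t) = cumul lam t + 1.
Proof.
move=> t0; have [|x x0 lx] := @cumul_surj _ lam (cumul lam t + 1) rlam.
  by rewrite addr_ge0// cumul_ge0//; exact: rate_nonneg.
have tx : t < x by rewrite -(cumul_ltE rlam)// lx ltrDl.
suff -> : entry t = x by [].
rewrite queue_timeE /transit (@inf_integ _ lam t (x - t) 1) ?subrKC//.
by rewrite subr_ge0 ltW.
Qed.

Lemma lt_entry_self t : 0 <= t -> t < entry t.
Proof. by case/entry_spec. Qed.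

Lemma cumul_entry t : 0 <= t -> cumul lam (entry t) = cumul lam t + 1.
Proof. by case/entry_spec. Qed.

Lemma entry_ge0 t : 0 <= t -> 0 <= entry t.
Proof. by move=> t0; rewrite (le_trans t0)// ltW// lt_entry_self. Qed.

Lemma entry_leE t x : 0 <= t -> 0 <= x -> (entry t <= entry x) = (t <= x).
Proof.
move=> t0 x0; rewrite -(cumul_leE rlam (entry_ge0 t0) (entry_ge0 x0)).
by rewrite !cumul_entry// lerD2r cumul_leE.
Qed.

Lemma entry_ltE t x : 0 <= t -> 0 <= x -> (entry t < entry x) = (t < x).
Proof. by move=> t0 x0; rewrite !ltNge entry_leE. Qed.

Lemma entry_surj x : entry 0 <= x -> exists2 t, 0 <= t & entry t = x.
Proof.
move=> ex; have x0 : 0 <= x by apply: le_trans ex; exact: entry_ge0.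
have [|t t0 lt] := @cumul_surj _ lam (cumul lam x - 1) rlam.
  rewrite subr_ge0 -[leLHS]add0r -[X in X + _](cumul0 lam) -cumul_entry//.
  by rewrite cumul_leE// entry_ge0.
exists t => //; apply: (cumul_inj rlam); rewrite ?entry_ge0//.
by rewrite cumul_entry// lt subrK.
Qed.

Lemma speed_ratio_gt0 t : 0 <= t -> 0 < speed_ratio N e t.
Proof. by move=> t0; rewrite divr_gt0// rate_gt0// -queue_timeE entry_ge0. Qed.

(** [cumul lam] is affine just after [t] and just after [entry t]; the quotient of the two slopes is
    the speed ratio. *)
Lemma entry_right_affine t : 0 <= t ->
  exists2 eps : R, 0 < eps & forall h, 0 <= h < eps ->
    entry (t + h) = entry t + speed_ratio N e t * h.
Proof.
move=> t0; have et0 := entry_ge0 t0.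
have [e1 e10 He1] := cumul_right_affine rlam t0.
have [e2 e20 He2] := cumul_right_affine rlam et0.
have g0 := speed_ratio_gt0 t0; set g := speed_ratio N e t in g0 *.
(* The bound [e2 / g] keeps [entry t + g * h] within the affine piece after [entry t]. *)
exists (Num.min e1 (e2 / g)); first by rewrite lt_min e10/= divr_gt0.
move=> h /andP[h0]; rewrite lt_min => /andP[h1]; rewrite ltr_pdivlMr// => h2.
have gh0 : 0 <= g * h by rewrite mulr_ge0// ltW.
apply: (cumul_inj rlam); rewrite ?entry_ge0 ?addr_ge0//.
rewrite cumul_entry ?addr_ge0// He1 ?h0// He2; last by rewrite gh0 mulrC.
rewrite cumul_entry// /g /speed_ratio -queue_timeE.
by field; rewrite gt_eqF// rate_gt0.
Qed.

(** Real induction on [h] glues the local affine pieces. In the limit step, one inequality comes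
    from continuity of [cumul lam], the other from monotonicity of [entry]. *)
Lemma entry_affine t c g : 0 <= t -> 0 < g ->
    (forall h, 0 <= h < c -> speed_ratio N e (t + h) = g) ->
  forall h, 0 <= h <= c -> entry (t + h) = entry t + g * h.
Proof.
move=> t0 g0 tg; apply: real_induction.
- by rewrite mulr0 !addr0.
- move=> x /andP[x0 xc] xE.
  have [|eps eps0 He] := @entry_right_affine (t + x); first by rewrite addr_ge0.
  exists eps => // y /andP[xy ye].
  have -> : t + y = t + x + (y - x) by ring.
  rewrite He; last by rewrite subr_ge0 xy ltrBlDl.
  by rewrite xE tg ?x0//; ring.
- move=> x /andP[x0 xc] yE; set z := entry t + g * x.
  have tx0 : 0 <= t + x by rewrite addr_ge0// ltW.
  have z0 : 0 <= z by rewrite addr_ge0 ?entry_ge0// mulr_ge0// ltW.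
  apply/eqP; rewrite eq_le; apply/andP; split.
  + rewrite -(cumul_leE rlam (entry_ge0 tx0) z0) cumul_entry// -lerBrDr.
    apply: cumul_left_limit; [exact: rate_loc_integrable|lra|].
    move=> y /andP[y0 ytx]; rewrite lerBrDr -cumul_entry// cumul_leE ?entry_ge0//.
    have [ty|ty] := leP t y; last first.
      apply: (@le_trans _ _ (entry t)); first by rewrite entry_leE// ltW.
      by rewrite lerDl mulr_ge0// ltW.
    have -> : y = t + (y - t) by ring.
    rewrite yE; last by rewrite subr_ge0 ty ltrBlDl.
    by rewrite lerD2l ler_pM2l//; lra.
  + rewrite leNgt; apply/negP => xz.
    (* Were [entry (t + x)] too small, the earlier time [t + y] would already have this value,
       against strict monotonicity. *)
    pose y := (entry (t + x) - entry t) / g.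
    have y0 : 0 <= y by rewrite divr_ge0 ?ltW// subr_gt0 entry_ltE// ltrDl.
    have yx : y < x by rewrite ltr_pdivrMr// mulrC ltrBlDl.
    have : entry (t + y) < entry (t + x) by rewrite entry_ltE ?ltrD2l// addr_ge0.
    rewrite yE ?y0// mulrC divfK ?gt_eqF//.
    by rewrite subrKC ltxx.
Qed.

(** Just after [entry t] the inverse of [entry] is affine with slope [1 / g], so [ae_affine]
    transports the statement there; [ae_right_local] assembles these neighbourhoods. *)
Lemma ae_entry (P : R -> Prop) : {ae mu, forall t, 0 <= t -> P (entry t)} ->
  {ae mu, forall x, entry 0 <= x -> P x}.
Proof.
move=> aP; apply: ae_right_local => x /entry_surj[t t0 <-].
have g0 := speed_ratio_gt0 t0; have [e1 e10 He1] := entry_right_affine t0.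
set g := speed_ratio N e t in g0 He1.
exists (g * e1); first by rewrite mulr_gt0.
have gi0 : 0 < g^-1 by rewrite invr_gt0.
apply: ae_imp (@ae_affine _ _ _ (t - entry t / g) gi0 aP) => y Py /andP[ty yte].
pose h := (y - entry t) / g.
have h0 : 0 <= h by rewrite divr_ge0 ?subr_ge0// ltW.
have yE : entry (t + h) = y.
  rewrite He1 ?h0/=; first by rewrite /h; field; rewrite gt_eqF.
  by rewrite ltr_pdivrMr// ltrBlDl mulrC.
have thE : g^-1 * y + (t - entry t / g) = t + h.
  by rewrite /h; field; rewrite gt_eqF.
by move: Py; rewrite thE yE; apply; rewrite addr_ge0.
Qed.

End Transit.

(** * Queues and exit times in a feasible flow *)

HB.lock Definition leave (R : realType) (V E : finType)
  (N : network R V E) (f : flow R E) (e : E) (t : R) : R := exit_time N f e t.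
Canonical leave_unlockable := Unlockable leave.unlock.

Section Queue.
Context {R : realType} {V E : finType} (N : network R V E).
Context (f : flow R E) (e : E).
Local Notation mu := (@lebesgue_measure R).
Local Notation entry := (queue_time N e).
Local Notation nu := (cap N e).
Local Notation Fin := (cumul (inrate f e)).
Local Notation Fout := (cumul (outrate f e)).
Local Notation T := (leave N f e).
Implicit Types (t x : R).

Let rnu : rate_function nu. Proof. exact: capP. Qed.

Lemma queueE t : queue N f e t = Fin t - Fout (entry t).
Proof. by rewrite unlock queue_timeE. Qed.

Lemma waitingE t : waiting N f e t = T t - entry t.
Proof. by rewrite queue_timeE [leave]unlock /exit_time addrC addKr. Qed.

Lemma leave_eq t x : 0 <= t -> entry t <= x ->
  cumul nu x = cumul nu (entry t) + (Fin t - Fout (entry t)) -> T t = x.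
Proof.
move=> t0 tx nux; rewrite [leave]unlock /exit_time /waiting -queue_timeE.
rewrite (@inf_integ _ nu (entry t) (x - entry t)) ?subrKC ?subr_ge0//.
- exact: entry_ge0.
- by rewrite queueE.
Qed.

Section NonnegQueue.
Variable t : R.
Hypotheses (t0 : 0 <= t) (q0 : Fout (entry t) <= Fin t).

Let et0 : 0 <= entry t. Proof. exact: entry_ge0. Qed.

Lemma leave_spec :
  entry t <= T t /\ cumul nu (T t) = cumul nu (entry t) + (Fin t - Fout (entry t)).
Proof.
have [|x x0 nux] := @cumul_surj _ nu (cumul nu (entry t) + (Fin t - Fout (entry t))) rnu.
  by rewrite addr_ge0 ?subr_ge0// cumul_ge0//; exact: rate_nonneg.
have tx : entry t <= x by rewrite -(cumul_leE rnu et0 x0) nux lerDl subr_ge0.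
by rewrite (leave_eq t0 tx nux).
Qed.

Lemma le_entry_leave : entry t <= T t.
Proof. by case: leave_spec. Qed.

Lemma cumul_leave : cumul nu (T t) = cumul nu (entry t) + (Fin t - Fout (entry t)).
Proof. by case: leave_spec. Qed.

Lemma lt_leave_self : t < T t.
Proof. exact: lt_le_trans (lt_entry_self N e t0) le_entry_leave. Qed.

Lemma lt_entry_leave : (entry t < T t) = (Fout (entry t) < Fin t).
Proof.
rewrite -(cumul_ltE rnu et0 (le_trans et0 le_entry_leave)).
by rewrite cumul_leave ltrDl subr_gt0.
Qed.

End NonnegQueue.

Variable r : R -> R.
Hypothesis ff : feasible_flow N r f.

Let fot : flow_over_time N r f. Proof. by case: ff. Qed.

Lemma inrate_loc_integrable : loc_integrable (inrate f e).
Proof. by have [/(_ e)[]] := fot. Qed.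

Lemma outrate_loc_integrable : loc_integrable (outrate f e).
Proof. by have [/(_ e)[]] := fot. Qed.

Lemma inrate_nonneg : nonneg_rate (inrate f e).
Proof. by have [_ p _ _ _] := fot; move=> x /(p e)[]. Qed.

Lemma outrate_nonneg : nonneg_rate (outrate f e).
Proof. by have [_ p _ _ _] := fot; move=> x /(p e)[]. Qed.

Lemma queue_ge0 t : 0 <= t -> Fout (entry t) <= Fin t.
Proof.
by have [_ _ p _ _] := fot; move=> /(p e); rewrite unlock queue_timeE.
Qed.

Lemma outrate_queue : {ae mu, forall t, 0 <= t ->
  outrate f e (entry t) =
    if Fout (entry t) < Fin t then nu (entry t)
    else Num.min (inrate f e t / speed_ratio N e t) (nu (entry t))}.
Proof.
have [_ /(_ e) + _] := ff; apply: ae_imp => t + t0.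
by rewrite queueE subr_gt0 -queue_timeE; apply.
Qed.

Let io := outrate_loc_integrable.
Let po := outrate_nonneg.
Let ii := inrate_loc_integrable.
Let pi := inrate_nonneg.

Lemma leave_ge0 t : 0 <= t -> 0 <= T t.
Proof.
move=> t0; apply: le_trans (le_entry_leave t0 (queue_ge0 t0)).
exact: entry_ge0.
Qed.

Lemma outrate_le_cap : {ae mu, forall x, entry 0 <= x -> outrate f e x <= nu x}.
Proof.
apply: ae_entry; apply: ae_imp outrate_queue => t h t0.
by rewrite h//; case: ifP => // _; rewrite ge_min lexx orbT.
Qed.

Lemma cumul_out_le_cap t x : 0 <= t -> entry t <= x ->
  Fout x - Fout (entry t) <= cumul nu x - cumul nu (entry t).
Proof.
move=> t0 tx; have et0 := entry_ge0 N e t0.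
rewrite -!integB//; last exact: rate_loc_integrable.
apply: ae_le_integ => //; [exact: rate_loc_integrable|exact: rate_nonneg|].
apply: ae_imp outrate_le_cap => y h /andP[ty _]; apply: h.
by apply: le_trans ty; rewrite entry_leE.
Qed.

(** Outflow is bounded by capacity, so whatever entered by [t] and cannot be served before
    [entry t'] is still waiting then. Both the monotonicity of exit times and the persistence of
    queues come from this bound. *)
Lemma queue_lower t t' : 0 <= t -> t <= t' ->
  cumul nu (T t) - cumul nu (entry t') <= Fin t' - Fout (entry t').
Proof.
move=> t0 tt'; have t'0 := le_trans t0 tt'.
have ett' : entry t <= entry t' by rewrite entry_leE.
have h1 := cumul_out_le_cap t0 ett'.
have h2 : Fin t <= Fin t' by exact: le_cumul.
by rewrite (cumul_leave t0 (queue_ge0 t0)); lra.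
Qed.

Lemma leave_le t t' : 0 <= t -> t <= t' -> T t <= T t'.
Proof.
move=> t0 tt'; have t'0 := le_trans t0 tt'; have h := queue_lower t0 tt'.
rewrite -(cumul_leE rnu (leave_ge0 t0) (leave_ge0 t'0)).
by rewrite (cumul_leave t'0 (queue_ge0 t'0)) -lerBlDl.
Qed.

Lemma queue_busy t t' : 0 <= t -> t <= t' -> entry t' < T t ->
  Fout (entry t') < Fin t'.
Proof.
move=> t0 tt' lt; have t'0 := le_trans t0 tt'.
rewrite -subr_gt0; apply: lt_le_trans (queue_lower t0 tt').
by rewrite subr_gt0 (cumul_ltE rnu (entry_ge0 N e t'0) (leave_ge0 t0)).
Qed.

(** Every time in the interval is [entry t'] for some [t' >= t], and there the queue is nonempty by
    [queue_busy]. *)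
Lemma outrate_busy t : 0 <= t ->
  {ae mu, forall x, entry t <= x < T t -> outrate f e x = nu x}.
Proof.
move=> t0.
pose P x := entry t <= x < T t -> outrate f e x = nu x.
have : {ae mu, forall x, entry 0 <= x -> P x}.
  apply: ae_entry; apply: ae_imp outrate_queue => t' h t'0 /andP[].
  by rewrite entry_leE// => tt' /(queue_busy t0 tt') q; rewrite h// q.
apply: ae_imp => x Px xt; apply: Px => //; case/andP: xt => tx _.
by apply: le_trans tx; rewrite entry_leE.
Qed.

(** The arc works at capacity from [entry t] to [T t], so it serves exactly the queue met at [t]:
    first in, first out. *)
Lemma cumul_out_leave t : 0 <= t -> Fout (T t) = Fin t.
Proof.
move=> t0; have et0 := entry_ge0 N e t0; have q0 := queue_ge0 t0.
have le := le_entry_leave t0 q0.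
have : integ (outrate f e) (entry t) (T t) = integ nu (entry t) (T t).
  apply: ae_eq_integ => //; [exact: rate_loc_integrable|exact: rate_nonneg|].
  exact: outrate_busy.
rewrite !integB//; last exact: rate_loc_integrable.
by rewrite cumul_leave//; lra.
Qed.

End Queue.



(** * Earliest arrival times: monotonicity, uniqueness and existence *)

Section Labels.
Context {R : realType} {V E : finType} (N : network R V E).
Local Notation T := (leave N).
Implicit Types (f : flow R E) (r : R -> R) (l : V -> R -> R) (psi : R).

Lemma ell_src_eq psi t : 0 <= t -> cumul (inflow N) t = psi ->
  ell_src N psi = t.
Proof.
move=> t0 It; have := @inf_integ _ (inflow N) 0 t psi (inflowP N) (lexx 0) t0.
rewrite add0r cumul0 add0r => /(_ It) <-; rewrite /ell_src; congr inf.
by apply/seteqP; split => q /=; rewrite add0r.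
Qed.

Lemma ell_src_spec psi : 0 <= psi ->
  0 <= ell_src N psi /\ cumul (inflow N) (ell_src N psi) = psi.
Proof.
move=> /(cumul_surj (inflowP N))[t t0 It].
by rewrite (ell_src_eq t0 It).
Qed.

Lemma ell_src_le psi psi' : 0 <= psi -> psi <= psi' ->
  ell_src N psi <= ell_src N psi'.
Proof.
move=> p0 pp'; have [t0 It] := ell_src_spec p0.
have [t'0 It'] := ell_src_spec (le_trans p0 pp').
by rewrite -(cumul_leE (inflowP N))// It It'.
Qed.

Lemma label_attained f l psi v : earliest_arrival N f l -> 0 <= psi ->
  v != src N ->
  exists2 e, head N e = v & l v psi = T f e (l (tail N e) psi).
Proof.
move=> la p0 vs; have [_ _ /(_ v vs)[[e he <-] _]] := la psi p0.
by exists e => //; rewrite unlock.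
Qed.

Lemma label_ge0 f l psi v : earliest_arrival N f l -> 0 <= psi -> 0 <= l v psi.
Proof. by move=> la /la[]. Qed.

Lemma label_src f l psi : earliest_arrival N f l -> 0 <= psi ->
  l (src N) psi = ell_src N psi.
Proof. by move=> la /la[]. Qed.

Lemma activeP f l psi e :
  reflect (l (head N e) psi = T f e (l (tail N e) psi))
    (e \in active_arcs N f l psi).
Proof. by rewrite inE unlock; exact: eqP. Qed.

Section Feasible.
Context (f : flow R E) (r : R -> R).
Hypothesis ff : feasible_flow N r f.

Lemma leave_gt e t : 0 <= t -> t < T f e t.
Proof. by move=> t0; apply: lt_leave_self => //; exact: queue_ge0 ff _ _. Qed.

(** A node of smallest label must be the source: any other label is attained through an arc whose
    tail has a strictly smaller one, as crossing takes positive time. *)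
Lemma src_label_le l psi v : earliest_arrival N f l -> 0 <= psi ->
  l (src N) psi <= l v psi.
Proof.
move=> la p0; have [u _ umin] := @arg_minP _ _ _ v xpredT (l^~ psi) isT.
suff <- : u = src N by exact: umin.
apply/eqP; apply: contraT => /(label_attained la p0)[e _ uE].
have := umin (tail N e) isT; rewrite uE leNgt leave_gt//.
exact: label_ge0 la p0.
Qed.

Lemma label_le_leave l psi e : earliest_arrival N f l -> 0 <= psi ->
  l (head N e) psi <= T f e (l (tail N e) psi).
Proof.
move=> la p0; have [he|he] := eqVneq (head N e) (src N); last first.
  have [_ _ /(_ _ he)[_ lb]] := la psi p0.
  by apply: lb; exists e; rewrite // unlock.
rewrite he; apply: le_trans (src_label_le (tail N e) la p0) (ltW _).
by apply: leave_gt; exact: label_ge0 la p0.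
Qed.

Lemma active_head_neq_src l psi e : earliest_arrival N f l -> 0 <= psi ->
  e \in active_arcs N f l psi -> head N e != src N.
Proof.
move=> la p0 /activeP he; apply/eqP => hs.
have := src_label_le (tail N e) la p0; rewrite -hs he leNgt.
by rewrite leave_gt//; exact: label_ge0 la p0.
Qed.

(** Taking [l1 = l2] gives monotonicity, [psi1 = psi2] uniqueness. Among the nodes violating the
    inequality, take one with smallest [l2]. The arc attaining this label has a tail of strictly
    smaller label, where the inequality holds, and monotone exit times carry it over to the head. *)
Lemma label_le l1 l2 psi1 psi2 v : earliest_arrival N f l1 ->
  earliest_arrival N f l2 -> 0 <= psi1 -> psi1 <= psi2 ->
  l1 v psi1 <= l2 v psi2.
Proof.
move=> la1 la2 p10 p12; have p20 := le_trans p10 p12.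
rewrite leNgt; apply/negP => vbad.
case: (@arg_minP _ _ _ v (fun v => l2 v psi2 < l1 v psi1) (l2^~ psi2) vbad).
move=> u ubad umin; have [us|us] := eqVneq u (src N).
  move: ubad; rewrite us (label_src la1)// (label_src la2)//.
  by rewrite ltNge ell_src_le.
have [e eu uE] := label_attained la2 p20 us.
have l20 := label_ge0 (tail N e) la2 p20.
have l10 := label_ge0 (tail N e) la1 p10.
have : l1 (tail N e) psi1 <= l2 (tail N e) psi2.
  rewrite leNgt; apply/negP => /umin; rewrite uE leNgt.
  by rewrite leave_gt.
move=> /(leave_le e ff l10); rewrite -uE => le.
move: ubad; rewrite ltNge -eu => /negP; apply.
by apply: le_trans (label_le_leave e la1 p10) _; rewrite eu.
Qed.

Lemma label_unique l1 l2 psi v : earliest_arrival N f l1 ->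
  earliest_arrival N f l2 -> 0 <= psi -> l1 v psi = l2 v psi.
Proof.
by move=> la1 la2 p0; apply/eqP; rewrite eq_le !(label_le (psi1 := psi)).
Qed.

(** Keeps Dijkstra's algorithm from getting stuck: a path from the source to [v] has to leave
    [S]. *)
Lemma crossing_arc (S : {set V}) v : src N \in S -> v \notin S ->
  exists e, (tail N e \in S) && (head N e \notin S).
Proof.
move=> sS vS; apply: contrapT => ncross; move: vS; apply/negP; rewrite negbK.
have /connectP[p pth ->] := src_reach N v.
elim: p (src N) sS pth => //= w p IH u uS /andP[/existsP[e /andP[/eqP te /eqP he]]].
apply: IH; apply: contrapT => /negP wS; apply: ncross; exists e.
by rewrite te he uS.
Qed.

(* Dijkstra's algorithm; only [t < T e t] is used, not the monotonicity of the
   exit times. *)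
Lemma label_exists psi : 0 <= psi -> exists lab : V -> R,
  [/\ forall v, 0 <= lab v, lab (src N) = ell_src N psi
    & forall v, v != src N ->
        is_min [set T f e (lab (tail N e)) | e in [set e | head N e = v]]
          (lab v)].
Proof.
move=> p0; have [t00 _] := ell_src_spec p0; set t0 := ell_src N psi in t00 *.
(* By the last clause of the invariant each new label is at least all earlier ones, so that arcs
   leading from the new node back into [S] cannot undercut settled labels. *)
suff dijkstra k : (k < #|V|)%N -> exists (S : {set V}) (lab : V -> R),
  [/\ #|S| = k.+1, src N \in S /\ lab (src N) = t0,
      forall v, v \in S -> 0 <= lab v /\ (v != src N ->
        exists e, [/\ head N e = v, tail N e \in S
          & lab v = T f e (lab (tail N e))]),
      forall e, tail N e \in S -> head N e \in S -> head N e != src N ->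
        lab (head N e) <= T f e (lab (tail N e))
    & forall e w, tail N e \in S -> head N e \notin S -> w \in S ->
        lab w <= T f e (lab (tail N e))].
  have V0 : (0 < #|V|)%N by apply/card_gt0P; exists (src N).
  have [|S [lab [cS [sS ls] la lb _]]] := dijkstra #|V|.-1; first by rewrite prednK.
  have ST v : v \in S.
    suff -> : S = [set: V]%SET by rewrite inE.
    by apply/eqP; rewrite eqEcard finset.subsetT cardsT cS prednK/=.
  exists lab; split => // [v|v vs]; first by have [] := la v (ST v).
  have [_ /(_ vs)[e [he _ vE]]] := la v (ST v); split; first by exists e.
  by move=> _ [e' he' <-]; rewrite -he'; apply: lb; rewrite // he'.
elim: k => [_|k IH k1].
  exists [set src N]%SET, (fun=> t0); split.
  - by rewrite cards1.
  - by rewrite inE eqxx.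
  - by move=> v; rewrite inE => /eqP ->; rewrite eqxx.
  - by move=> e _; rewrite inE => /eqP ->; rewrite eqxx.
  - by move=> e w _ _ _; apply/ltW/leave_gt.
have [S [lab [cS [sS ls] la lb lc]]] := IH (ltnW k1).
have [v vS] : exists v, v \notin S.
  apply: contrapT => nv; move: k1; rewrite -cS ltnNge => /negP; apply.
  apply: subset_leq_card; apply/fintype.subsetP => v _.
  by apply: contrapT => /negP ?; apply: nv; exists v.
have [e1 cross1] := crossing_arc sS vS.
(* The next settled node is the head of the arc out of [S] with the earliest exit time. *)
case: (@arg_minP _ _ _ e1 (fun e => (tail N e \in S) && (head N e \notin S))
  (fun e => T f e (lab (tail N e))) cross1) => e0 /andP[t0S h0S] e0min.
set m := T f e0 (lab (tail N e0)) in e0min.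
have [l0 _] := la _ t0S; have lm := leave_gt e0 l0; rewrite -/m in lm.
have m0 := le_trans l0 (ltW lm).
pose v0 := head N e0; pose lab' u := if u == v0 then m else lab u.
have lab'S u : u \in S -> lab' u = lab u.
  by move=> uS; rewrite /lab'; case: eqP => // uv; move: h0S; rewrite -/v0 -uv uS.
have lab'v : lab' v0 = m by rewrite /lab' eqxx.
exists (v0 |: S)%SET, lab'; split.
- by rewrite cardsU1 h0S cS.
- by rewrite inE sS orbT lab'S.
- move=> u; rewrite !inE => /orP[/eqP ->|uS].
    rewrite lab'v; split => // _; exists e0.
    by rewrite !inE t0S orbT lab'S.
  rewrite lab'S//; have [u0 ua] := la u uS; split => // /ua[e [eu te uE]].
  by exists e; rewrite !inE te orbT lab'S.
- move=> e; rewrite !inE => /orP[/eqP te|te] /orP[/eqP he|he] hs.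
  + by rewrite te he lab'v ltW// leave_gt.
  + rewrite te lab'S// lab'v; apply: le_trans (lc _ _ t0S h0S he) _.
    by rewrite ltW// leave_gt.
  + rewrite he lab'v lab'S//; apply: e0min; rewrite te/=.
    by rewrite he.
  + by rewrite !lab'S//; exact: lb.
- move=> e w; rewrite !inE negb_or => /orP[/eqP te|te] /andP[hv hS].
    rewrite te lab'v => /orP[/eqP ->|wS]; first by rewrite lab'v ltW// leave_gt.
    by rewrite lab'S// (le_trans (lc _ _ t0S h0S wS))// ltW// leave_gt.
  rewrite (lab'S _ te) => /orP[/eqP ->|wS]; last by rewrite lab'S//; exact: lc.
  by rewrite lab'v; apply: e0min; rewrite te hS.
Qed.

Lemma earliest_arrival_exists : exists l, earliest_arrival N f l.
Proof.
have /choice[l lP] : forall psi, exists lab : V -> R, 0 <= psi ->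
  [/\ forall v, 0 <= lab v, lab (src N) = ell_src N psi
    & forall v, v != src N ->
        is_min [set T f e (lab (tail N e)) | e in [set e | head N e = v]]
          (lab v)].
  (* Negative particles are unconstrained and get the default label 0. *)
  move=> psi; have [p0|p0] := leP 0 psi; last by exists (fun=> 0).
  by have [lab labP] := label_exists p0; exists lab.
by exists (fun v psi => l psi v) => psi /lP; rewrite [leave]unlock.
Qed.

End Feasible.
End Labels.

(** * Arc flow of a restricted Nash flow relative to the labels of [phi] *)

Section RestrictedNash.
Context {R : realType} {V E : finType} (N : network R V E).
Context (f : flow R E) (l : V -> R -> R) (phi : R).
Local Notation mu := (@lebesgue_measure R).
Hypothesis phi0 : 0 <= phi.
Hypothesis f_nash : restricted_nash N f phi.
Hypothesis la : earliest_arrival N f l.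

Lemma nash_feasible : feasible_flow N (truncated_inflow N phi) f.
Proof. by case: f_nash. Qed.

Let ff := nash_feasible.

(** The Nash condition comes with labels of its own; by uniqueness they agree with the given [l] on
    nonnegative particles. *)
Lemma nash_active e : {ae mu, forall t : R, 0 <= t -> 0 < inrate f e t ->
  exists psi, [/\ 0 <= psi, psi <= phi, e \in active_arcs N f l psi
    & l (tail N e) psi = t]}.
Proof.
have [_ [l1 la1 /(_ e) h]] := f_nash; apply: ae_imp h => t + t0 it.
move=> /(_ t0 it)[psi [/andP[p0 pphi] /activeP act] <-].
exists psi; split => //; last exact: (label_unique ff _ la la1 p0).
by apply/activeP; rewrite !(label_unique ff _ la la1 p0).
Qed.

Variable e : E.
Local Notation entry := (queue_time N e).
Local Notation nu := (cap N e).
Local Notation Fin := (cumul (inrate f e)).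
Local Notation Fout := (cumul (outrate f e)).
Local Notation T := (leave N f e).
Local Notation Lu := (l (tail N e) phi).
Local Notation Lv := (l (head N e) phi).

Let Lu0 : 0 <= Lu. Proof. exact: label_ge0 la phi0. Qed.
Let Lv0 : 0 <= Lv. Proof. exact: label_ge0 la phi0. Qed.
Let io := outrate_loc_integrable e ff.
Let po := outrate_nonneg e ff.
Let ii := inrate_loc_integrable e ff.
Let pi := inrate_nonneg e ff.

(* Every particle in [0, phi] using the arc has left it by time [l v phi]: up to
   the last time at which it is used by some [psi], this is the first-in
   first-out identity at [psi]. *)
Lemma nash_inflow_le t : 0 <= t -> Fin t <= Fout Lv.
Proof.
pose A := [set l (tail N e) psi | psi in
  [set psi | [/\ 0 <= psi, psi <= phi & e \in active_arcs N f l psi]]].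
have Aub : ubound A Lu.
  by move=> _ [psi [p0 pphi _] <-]; apply: (label_le ff _ la la p0 pphi).
have Asup y : A y -> y <= sup A by apply: ub_le_sup; exists Lu.
have A0 y : A y -> 0 <= y by move=> [psi [p0 _ _] <-]; exact: label_ge0 la p0.
have FA y : A y -> Fin y <= Fout Lv.
  move=> [psi [p0 pphi /activeP act] <-].
  rewrite -(cumul_out_leave _ ff) ?(label_ge0 _ la p0)// -act.
  by apply: le_cumul => //; [exact: label_ge0 la p0|exact: (label_le ff _ la la p0 pphi)].
have s0 : 0 <= sup A.
  (* If no particle uses the arc, [sup A] is the default value 0. *)
  have [->|/set0P[y Ay]] := eqVneq A set0; first by rewrite sup0.
  exact: le_trans (A0 _ Ay) (Asup _ Ay).
have Fs : Fin (sup A) <= Fout Lv.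
  move: s0; rewrite le_eqVlt => /predU1P[<-|s0].
    by rewrite cumul0 cumul_ge0.
  apply: cumul_left_limit => // y /andP[y0 ys].
  have [AE|/set0P nA] := eqVneq A set0.
    by move: ys; rewrite AE sup0 ltNge y0.
  have sy : 0 < sup A - y by rewrite subr_gt0.
  have [a Aa] := sup_adherent sy (conj nA (ex_intro _ Lu Aub)).
  rewrite subKr => ya; apply: le_trans (FA a Aa).
  by apply: le_cumul => //; exact: ltW.
move=> t0; have [ts|st] := leP t (sup A).
  by apply: le_trans Fs; exact: le_cumul.
(* After [sup A] the Nash condition forces zero inflow almost everywhere. The point [sup A] itself
   may lie in [A] and is discarded. *)
apply: le_trans Fs; rewrite -subr_le0 -integB//; last exact: ltW.
rewrite (@ae_cst_integ _ _ 0 (sup A) t)//; first by rewrite mul0r.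
  exact: ltW.
apply: ae_imp (ae_and (nash_active e) (ae_neq (sup A))) => y [yP ys].
move=> /andP[sy _]; have y0 := le_trans s0 sy; apply/eqP; rewrite eq_le pi// andbT.
rewrite leNgt; apply/negP => /(yP y0)[psi [p0 pphi act lE]]; apply: ys.
by apply/eqP; rewrite eq_le sy andbT; apply: Asup; exists psi.
Qed.

(** One bound is [nash_inflow_le]; the other is the first-in first-out identity at [Lu], because
    [Lv <= T Lu]. *)
Lemma nash_out_label : Fout Lv = Fin Lu.
Proof.
apply/eqP; rewrite eq_le nash_inflow_le// andbT -(cumul_out_leave e ff Lu0).
by apply: le_cumul => //; exact: (label_le_leave ff e la phi0).
Qed.

(** Outflow by [x] is at most the total inflow, which has already left by [Lv]. *)
Lemma nash_out_after x : Lv <= x -> Fout x = Fin Lu.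
Proof.
move=> vx; have x0 := le_trans Lv0 vx.
apply/eqP; rewrite -nash_out_label eq_le (le_cumul io po Lv0 vx) andbT.
apply: le_trans (nash_inflow_le x0); apply: le_trans (queue_ge0 e ff x0).
by apply: le_cumul => //; exact/ltW/lt_entry_self.
Qed.

Lemma resetting_arcsE :
  (e \in resetting_arcs N f l phi) = (Fout (entry Lu) < Fin Lu).
Proof.
rewrite inE waitingE subr_gt0 lt_entry_leave//.
exact: (queue_ge0 e ff Lu0).
Qed.

(** A particle entering an active arc at [t] gets the head label [T t >= entry t], whereas particles
    up to [phi] have head label at most [Lv]. *)
Lemma nash_inrate_late :
  {ae mu, forall t : R, 0 <= t -> Lv < entry t -> inrate f e t = 0}.
Proof.
apply: ae_imp (nash_active e) => t tP t0 vt; apply/eqP.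
rewrite eq_le pi// andbT leNgt; apply/negP => /(tP t0)[psi [p0 pphi /activeP act lE]].
have := label_le ff (head N e) la la p0 pphi.
rewrite act lE leNgt => /negP; apply.
exact: lt_le_trans (le_entry_leave t0 (queue_ge0 e ff t0)).
Qed.

End RestrictedNash.

(** * Positivity of the label slopes of a thin flow *)

Section ThinFlowFacts.
Context {R : realType} {V E : finType} (N : network R V E).
Variables (A Estar : {set E}) (nu gamma : E -> R) (r : R).
Variables (x' : E -> R) (l' : V -> R).
Hypothesis thin : thin_flow N A Estar nu gamma r x' l'.
Hypotheses (nu0 : forall e, e \in A -> 0 < nu e) (r0 : 0 < r).
Local Notation rho := (rho N Estar nu gamma l' x').

Lemma thin_flow_ge0 e : e \in A -> 0 <= x' e.
Proof. by case: thin => -[+ _ _] _ _ _; apply. Qed.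

Lemma thin_flow_le_rho e : x' e / nu e <= rho e.
Proof. by rewrite /rho; case: ifP => // _; rewrite le_max lexx orbT. Qed.

Lemma thin_rho_ge0 e : e \in A -> 0 <= rho e.
Proof.
move=> eA; apply: le_trans (thin_flow_le_rho e).
by rewrite divr_ge0 ?thin_flow_ge0// ltW// nu0.
Qed.

Lemma thin_label_src : l' (src N) = r^-1.
Proof. by case: thin. Qed.

Lemma thin_label_attained v : v != src N ->
  exists e, [/\ e \in A, head N e = v & l' v = rho e].
Proof. by case: thin => _ _ /(_ v) + _ vs => /(_ vs)[[e [eA eh] <-] _]; exists e. Qed.

Lemma thin_label_le e : e \in A -> head N e != src N -> l' (head N e) <= rho e.
Proof. by case: thin => _ _ + _ eA hs => /(_ _ hs)[_]; apply; exists e. Qed.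

Lemma thin_label_eq e : e \in A -> 0 < x' e -> l' (head N e) = rho e.
Proof. by case: thin => _ _ _; apply. Qed.

Lemma thin_label_ge0 v : 0 <= l' v.
Proof.
have [->|/thin_label_attained[e [eA _ ->]]] := eqVneq v (src N).
  by rewrite thin_label_src invr_ge0 ltW.
exact: thin_rho_ge0.
Qed.

Lemma thin_label_head_gt0 e : e \in A -> 0 < x' e -> 0 < l' (head N e).
Proof.
move=> eA xe; rewrite thin_label_eq//; apply: lt_le_trans (thin_flow_le_rho e).
by rewrite divr_gt0// nu0.
Qed.

Let out v := \sum_(e in A | tail N e == v) x' e.
Let inn v := \sum_(e in A | head N e == v) x' e.

(** The net outflows of all nodes sum to 0, every arc being counted once at each end. *)
Lemma thin_flow_sink : out (snk N) - inn (snk N) = - 1.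
Proof.
have : \sum_v (out v - inn v) = 0.
  rewrite sumrB; apply/eqP; rewrite subr_eq0; apply/eqP.
  by rewrite -(partition_big (tail N) xpredT)// -(partition_big (head N) xpredT).
case: thin => -[_ cons csrc] _ _ _.
rewrite (bigD1 (src N))//= (bigD1 (snk N))/=; last by rewrite eq_sym src_neq_snk.
rewrite big1 => [|v /andP[vs vt]]; last exact: cons.
by rewrite csrc addr0 => /eqP; rewrite addr_eq0 => /eqP h; rewrite h opprK.
Qed.

(** Makes the appended inflow rate [x' / l'] a genuine quotient wherever flow is sent. If the slope
    at the tail were 0, no arc entering it could carry flow, since heads of such arcs have positive
    slope; but then the flow on [e] contradicts conservation, or the negative net outflow at the
    sink. *)
Lemma thin_label_tail_gt0 e : e \in A -> 0 < x' e -> 0 < l' (tail N e).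
Proof.
move=> eA xe; rewrite lt_neqAle thin_label_ge0 andbT eq_sym; apply/eqP => lt0.
have ts : tail N e != src N.
  by apply/eqP => ts; move: lt0; rewrite ts thin_label_src => /eqP; rewrite invr_eq0 gt_eqF.
have inn0 : inn (tail N e) = 0.
  apply: big1 => e1 /andP[e1A /eqP e1h]; apply/eqP; rewrite eq_le thin_flow_ge0// andbT.
  by rewrite leNgt; apply/negP => /(thin_label_head_gt0 e1A); rewrite e1h lt0 ltxx.
have : 0 < out (tail N e).
  rewrite /out (bigD1 e) ?eA ?eqxx//= ltr_pwDl// sumr_ge0// => e1 /andP[/andP[? _] _].
  exact: thin_flow_ge0.
have [tt|tt] := eqVneq (tail N e) (snk N).
  by move: inn0 thin_flow_sink; rewrite -tt => ->; lra.
case: thin => -[_ /(_ _ ts tt) + _] _ _ _.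
by rewrite -/(out _) -/(inn _) inn0; lra.
Qed.

End ThinFlowFacts.

(** * Appending a constant piece to a rate *)

Section ExtendRate.
Context {R : realType}.
Local Notation mu := (@lebesgue_measure R).
Variables (g : R -> R) (a b c : R).
Local Notation ext := (extend_rate g a b c).
Hypotheses (a0 : 0 <= a) (ab : a <= b) (c0 : 0 <= c).
Hypotheses (gi : loc_integrable g) (g0 : nonneg_rate g).

Lemma extend_rate_before t : t < a -> ext t = g t.
Proof. by rewrite /extend_rate => ->. Qed.

Lemma extend_rate_mid t : a <= t < b -> ext t = c.
Proof. by rewrite /extend_rate => /andP[]; rewrite leNgt => /negbTE -> ->. Qed.

Lemma extend_rate_after t : b <= t -> ext t = 0.
Proof.
move=> bt; rewrite /extend_rate !ifF//; apply/negbTE; rewrite -leNgt//.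
exact: le_trans bt.
Qed.

Lemma extend_rate_nonneg : nonneg_rate ext.
Proof.
by move=> t t0; rewrite /extend_rate; case: ifP => _; [exact: g0|case: ifP].
Qed.

(** The extended rate is measurable as a case distinction over half-lines, and dominated by
    [g + c]. *)
Lemma extend_rate_loc_integrable : loc_integrable ext.
Proof.
move=> d.
have gd : mu.-integrable `[0, d] (EFin \o (fun t => g t + c)).
  have := integrableD _ (gi d) (loc_integrable_cst c d).
  by apply.
apply: le_integrable gd => //.
  apply/measurable_realfun.measurable_EFinP; apply: measurable_fun_if => //.
  - exact: measurable_realfun.measurable_fun_ltr.
  - apply: (measurable_funS (measurable_itv `[0, d])) => //.
    by apply/measurable_realfun.measurable_EFinP; exact: measurable_int (gi d).
  - apply: measurable_fun_if => //.
    + apply: measurableI => //.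
      have -> : (fun x : R => x < a) @^-1` [set false] = `[a, +oo[%classic.
        apply/seteqP; split => x /=; rewrite in_itv/= andbT leNgt; first by move=> ->.
        by move/negbTE.
      exact: measurable_itv.
    + exact: measurable_realfun.measurable_fun_ltr.
move=> t; rewrite /= in_itv/= => /andP[t0 _].
rewrite lee_fin !ger0_norm ?addr_ge0 ?extend_rate_nonneg ?g0//.
rewrite /extend_rate; case: ifP => _; first by rewrite lerDl.
by case: ifP => _; rewrite ?lerDr ?addr_ge0// g0.
Qed.

Lemma extend_rate_bounded : [bounded g t | t in `[0, +oo[%classic] ->
  [bounded ext t | t in `[0, +oo[%classic].
Proof.
move=> [M [_ gM]]; exists (Num.max M c); split; first exact: num_real.
move=> y; rewrite gt_max => /andP[My cy] t t0 /=.
rewrite /extend_rate; case: ifP => _; first exact: gM.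
case: ifP => _; first by rewrite ger0_norm// ltW.
by rewrite normr0 (le_trans c0)// ltW.
Qed.

Lemma cumul_extend_before t : 0 <= t -> t <= a -> cumul ext t = cumul g t.
Proof.
move=> t0 ta; rewrite [cumul]unlock; apply: ae_eq_integ => //.
- exact: extend_rate_loc_integrable.
- exact: extend_rate_nonneg.
by apply: ae_triv => y /andP[_ yt]; rewrite extend_rate_before// (lt_le_trans yt).
Qed.

Lemma cumul_extend_mid t : a <= t <= b -> cumul ext t = cumul g a + c * (t - a).
Proof.
move=> /andP[at_ tb]; rewrite -(cumul_extend_before a0 (lexx _)).
rewrite -(@ae_cst_integ _ ext c a t)//.
- by rewrite integB ?subrKC//; exact: extend_rate_loc_integrable.
- exact: extend_rate_loc_integrable.
- exact: extend_rate_nonneg.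
by apply: ae_triv => y /andP[ay yt]; rewrite extend_rate_mid// ay (lt_le_trans yt).
Qed.

Lemma cumul_extend_after t : b <= t -> cumul ext t = cumul g a + c * (b - a).
Proof.
move=> bt; rewrite -(@cumul_extend_mid b) ?ab ?lexx//.
apply/eqP; rewrite -subr_eq0 -integB//.
- rewrite (@ae_cst_integ _ ext 0 b t) ?mul0r//.
  + exact: extend_rate_loc_integrable.
  + exact: extend_rate_nonneg.
  + exact: le_trans ab.
  + by apply: ae_triv => y /andP[by_ _]; rewrite extend_rate_after.
- exact: extend_rate_loc_integrable.
- exact: le_trans ab.
Qed.

End ExtendRate.

(** Turns a time in an appended interval into the offset [xi] of the particle reaching the node
    then; a nonempty interval excludes slope 0. *)
Lemma affine_param (R : realType) (a m alpha t : R) : 0 <= m ->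
  a <= t < a + alpha * m ->
  0 < m /\ exists xi : R, [/\ 0 <= xi, xi < alpha & t = a + xi * m].
Proof.
move=> m0 /andP[at_ tM]; have mp : 0 < m.
  rewrite lt_neqAle m0 andbT; apply/eqP => mE.
  by move: (le_lt_trans at_ tM); rewrite -mE mulr0 addr0 ltxx.
split=> //; exists ((t - a) / m); split.
- by rewrite divr_ge0// subr_ge0.
- by rewrite ltr_pdivrMr// ltrBlDl.
- by rewrite divfK ?gt_eqF// subrKC.
Qed.

(** * A single arc in the extension phase, with flow value [x] and label slopes [lu], [lv] *)

Section ExtendedArc.
Context {R : realType} {V E : finType} (N : network R V E).
Context (f fx : flow R E) (l : V -> R -> R) (phi : R) (e : E).
Local Notation mu := (@lebesgue_measure R).
Hypothesis phi0 : 0 <= phi.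
Hypothesis f_nash : restricted_nash N f phi.
Hypothesis la : earliest_arrival N f l.
Local Notation entry := (queue_time N e).
Local Notation nu := (cap N e).
Local Notation gam := (speed_ratio N e).
Local Notation Fin := (cumul (inrate f e)).
Local Notation Fout := (cumul (outrate f e)).
Local Notation Gin := (cumul (inrate fx e)).
Local Notation Gout := (cumul (outrate fx e)).
Local Notation active := (e \in active_arcs N f l phi).
Local Notation Lu := (l (tail N e) phi).
Local Notation Lv := (l (head N e) phi).
Variables (alpha lu lv x : R).
Hypotheses (alpha0 : 0 < alpha) (lu0 : 0 <= lu) (lv0 : 0 <= lv) (x0 : 0 <= x).
Hypotheses (x_lu : 0 < x -> 0 < lu) (x_lv : 0 < x -> 0 < lv).
Local Notation Mu := (Lu + alpha * lu).
Local Notation Mv := (Lv + alpha * lv).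
Hypothesis fxi : inrate fx e = extend_rate (inrate f e) Lu Mu (x / lu).
Hypothesis fxo : outrate fx e = extend_rate (outrate f e) Lv Mv (x / lv).
Local Notation X := (Fin Lu).

Let Lu0 : 0 <= Lu. Proof. exact: label_ge0 la phi0. Qed.
Let Lv0 : 0 <= Lv. Proof. exact: label_ge0 la phi0. Qed.
Let ff := nash_feasible f_nash.
Let io := outrate_loc_integrable e ff.
Let po := outrate_nonneg e ff.
Let ii := inrate_loc_integrable e ff.
Let pi := inrate_nonneg e ff.
Let uM : Lu <= Mu. Proof. by rewrite lerDl mulr_ge0// ltW. Qed.
Let vM : Lv <= Mv. Proof. by rewrite lerDl mulr_ge0// ltW. Qed.
Let ci : 0 <= x / lu. Proof. exact: divr_ge0. Qed.
Let co : 0 <= x / lv. Proof. exact: divr_ge0. Qed.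
Let nuP : rate_function nu. Proof. exact: capP. Qed.

Lemma ext_outrate_loc_integrable : loc_integrable (outrate fx e).
Proof. by rewrite fxo; exact: extend_rate_loc_integrable. Qed.

Lemma ext_outrate_nonneg : nonneg_rate (outrate fx e).
Proof. by rewrite fxo; exact: extend_rate_nonneg. Qed.

Let gxo := ext_outrate_loc_integrable.
Let pxo := ext_outrate_nonneg.

Lemma ext_in_before t : 0 <= t -> t <= Lu -> Gin t = Fin t.
Proof. by rewrite fxi; exact: cumul_extend_before. Qed.

Lemma ext_out_before y : 0 <= y -> y <= Lv -> Gout y = Fout y.
Proof. by rewrite fxo; exact: cumul_extend_before. Qed.

Lemma ext_in_mid xi : 0 <= xi <= alpha -> Gin (Lu + xi * lu) = X + xi * x.
Proof.
move=> /andP[xi0 xia]; rewrite fxi cumul_extend_mid//; last first.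
  by rewrite lerDl mulr_ge0//= lerD2l ler_wpM2r.
(* Without flow the slope [lu] may be 0, so this case is split off before cancelling. *)
congr (_ + _); move: x0; rewrite le_eqVlt => /predU1P[<-|/x_lu lup].
  by rewrite mul0r mul0r mulr0.
by field; rewrite gt_eqF.
Qed.

Lemma ext_out_mid xi : 0 <= xi <= alpha -> Gout (Lv + xi * lv) = X + xi * x.
Proof.
move=> /andP[xi0 xia]; rewrite fxo cumul_extend_mid//; last first.
  by rewrite lerDl mulr_ge0//= lerD2l ler_wpM2r.
rewrite (nash_out_label phi0 f_nash la).
congr (_ + _); move: x0; rewrite le_eqVlt => /predU1P[<-|/x_lv lvp].
  by rewrite mul0r mul0r mulr0.
by field; rewrite gt_eqF.
Qed.

Let alphaI : 0 <= alpha <= alpha. Proof. by rewrite lexx andbT ltW. Qed.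

Lemma ext_in_after t : Mu <= t -> Gin t = X + alpha * x.
Proof.
move=> ut; rewrite -(ext_in_mid alphaI) fxi.
by rewrite !cumul_extend_after.
Qed.

Lemma ext_out_after y : Mv <= y -> Gout y = X + alpha * x.
Proof.
move=> vy; rewrite -(ext_out_mid alphaI) fxo.
by rewrite !cumul_extend_after.
Qed.

Lemma ext_in_idle t : x = 0 -> Lu <= t -> Gin t = X.
Proof.
move=> xE ut; have [tM|Mt] := leP t Mu; last first.
  by rewrite ext_in_after ?ltW// xE mulr0 addr0.
by rewrite fxi cumul_extend_mid ?ut// xE !mul0r addr0.
Qed.

Lemma ext_out_idle y : x = 0 -> Lv <= y -> Gout y = X.
Proof.
move=> xE vy; have [yM|My] := leP y Mv; last first.
  by rewrite ext_out_after ?ltW// xE mulr0 addr0.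
rewrite fxo cumul_extend_mid ?vy// xE !mul0r addr0.
exact: nash_out_label.
Qed.

Lemma ext_inrate_idle t : x = 0 -> Lu <= t -> inrate fx e t = 0.
Proof.
by rewrite fxi /extend_rate ltNge => -> ->/=; rewrite mul0r if_same.
Qed.

Lemma ext_outrate_idle y : x = 0 -> Lv <= y -> outrate fx e y = 0.
Proof.
by rewrite fxo /extend_rate ltNge => -> ->/=; rewrite mul0r if_same.
Qed.

Lemma active_entry_le : active -> entry Lu <= Lv.
Proof.
move=> /activeP ->; apply: le_entry_leave => //.
exact: (queue_ge0 e ff).
Qed.

Hypothesis idle_x : ~~ active -> x = 0.
Hypothesis idle_late : ~~ active -> forall xi : R, 0 <= xi < alpha ->
  Lv + xi * lv < entry (Lu + xi * lu).

Lemma idle_entry : ~~ active -> Lv < entry Lu.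
Proof.
by move=> /idle_late /(_ 0); rewrite lexx alpha0 !mul0r !addr0; apply.
Qed.

(** Past [Lv] the arc cannot be active, as that would give [entry t <= entry Lu <= Lv]. So nothing
    is appended, and the old outflow was complete at [Lv]. *)
Lemma ext_out_entry_before t : 0 <= t -> t <= Lu -> Gout (entry t) = Fout (entry t).
Proof.
move=> t0 tu; have [tv|vt] := leP (entry t) Lv.
  by rewrite ext_out_before// entry_ge0.
have nact : ~~ active.
  apply/negP => /active_entry_le; rewrite leNgt (lt_le_trans vt)//.
  by rewrite entry_leE.
rewrite ext_out_idle ?(idle_x nact)//; last exact: ltW.
by rewrite (nash_out_after phi0 f_nash la)// ltW.
Qed.

Lemma ext_leave_before t : 0 <= t -> t <= Lu -> leave N fx e t = leave N f e t.
Proof.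
move=> t0 tu; have q0 := queue_ge0 e ff t0; apply: leave_eq => //.
  exact: le_entry_leave.
by rewrite ext_in_before// ext_out_entry_before// cumul_leave.
Qed.

Section Idle.
Hypothesis nact : ~~ active.

Let late t : Lu <= t -> Lv <= entry t.
Proof.
move=> ut; apply: le_trans (ltW (idle_entry nact)) _.
by rewrite entry_leE// (le_trans Lu0).
Qed.

Lemma idle_queue t : Lu <= t -> Gout (entry t) = Gin t.
Proof.
by move=> ut; rewrite ext_out_idle ?ext_in_idle ?idle_x//; exact: late.
Qed.

Lemma idle_dynamics : {ae mu, forall t : R, Lu <= t -> outrate fx e (entry t) =
  if Gout (entry t) < Gin t then nu (entry t)
  else Num.min (inrate fx e t / gam t) (nu (entry t))}.
Proof.
apply: ae_triv => t ut; have t0 := le_trans Lu0 ut.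
rewrite idle_queue// ltxx ext_outrate_idle ?idle_x//; last exact: late.
rewrite ext_inrate_idle ?idle_x// mul0r min_l// ltW// rate_gt0//.
exact: entry_ge0.
Qed.

End Idle.

(** The rates are those of [f], unless [entry t] lies past [Lv]. Then the arc is inactive and
    carries no outflow, while in [f] the queue is empty and the inflow at [t] is 0 by
    [nash_inrate_late]. *)
Lemma dynamics_before : {ae mu, forall t : R, 0 <= t -> t < Lu ->
  outrate fx e (entry t) =
  if Gout (entry t) < Gin t then nu (entry t)
  else Num.min (inrate fx e t / gam t) (nu (entry t))}.
Proof.
(* At most one time satisfies [entry t = Lv]; discarding it makes the case distinction at [Lv]
   strict. *)
have nLv : {ae mu, forall t : R, 0 <= t -> entry t <> Lv}.
  have [[t1 t10 t1E]|none] := pselect (exists2 t1, 0 <= t1 & entry t1 = Lv).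
    apply: ae_imp (ae_neq t1) => t tt1 t0 tE; apply: tt1.
    by apply/eqP; rewrite eq_le -(entry_leE N e t0 t10) -(entry_leE N e t10 t0) tE t1E lexx.
  by apply: ae_triv => t t0 tE; apply: none; exists t.
have h := ae_and nLv (ae_and (outrate_queue e ff)
  (nash_inrate_late f_nash la e)).
apply: ae_imp h => t [tv [dyn idle]] t0 tu.
rewrite ext_out_entry_before ?ext_in_before ?(ltW tu)//.
have -> : inrate fx e t = inrate f e t by rewrite fxi extend_rate_before.
rewrite -dyn//; have [ev|ve] := ltP (entry t) Lv.
  by rewrite fxo extend_rate_before.
have {}ve : Lv < entry t by rewrite lt_neqAle ve andbT eq_sym; apply/eqP/tv.
have nact : ~~ active.
  apply/negP => /active_entry_le; rewrite leNgt (lt_trans ve)//.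
  by rewrite entry_ltE.
rewrite ext_outrate_idle ?idle_x ?(ltW ve)// dyn// idle//.
have et0 := entry_ge0 N e t0; have eu := entry_ltE N e t0 Lu0; rewrite tu in eu.
have : Fin t <= Fout (entry t).
  rewrite (nash_out_after phi0 f_nash la (ltW ve)).
  by apply: le_cumul => //; exact: ltW.
by rewrite leNgt => /negbTE ->; rewrite mul0r min_l// ltW// rate_gt0.
Qed.

Lemma outrate_early_ext :
    {ae mu, forall y : R, 0 <= y < entry 0 -> outrate f e y = 0} ->
  {ae mu, forall y : R, 0 <= y < entry 0 -> outrate fx e y = 0}.
Proof.
move=> h; apply: ae_imp h => y yP y0.
have [yv|vy] := ltP y Lv; first by rewrite fxo extend_rate_before// yP.
have [act|nact] := boolP active; last by rewrite ext_outrate_idle ?idle_x.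
case/andP: y0 => y0; rewrite ltNge => /negP[]; apply: le_trans vy.
by apply: le_trans (active_entry_le act); rewrite entry_leE.
Qed.

Section Active.
Hypothesis act : active.
Hypothesis cap_const : forall y, Lv <= y < Mv -> nu y = nu Lv.

(* The arc is served at full capacity throughout the extension phase. *)
Section Tight.
Hypothesis tight : x = nu Lv * lv.
Hypothesis lt_label : forall xi : R, 0 < xi < alpha ->
  entry (Lu + xi * lu) < Lv + xi * lv.

Let eLu0 : 0 <= entry Lu. Proof. exact: entry_ge0. Qed.

Let tight_rate y : Lv <= y < Mv -> outrate fx e y = nu y.
Proof.
move=> yv; rewrite fxo extend_rate_mid// cap_const// tight mulfK// gt_eqF//.
rewrite lt_neqAle lv0 andbT; apply/eqP => lE.
by case/andP: yv => vy; rewrite -lE mulr0 addr0 ltNge vy.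
Qed.

(** Before [Lv], which is [T Lu] on an active arc, the old queue is served at capacity; from [Lv] on
    the appended piece is. *)
Lemma tight_outrate : {ae mu, forall y, entry Lu <= y < Mv ->
  outrate fx e y = nu y}.
Proof.
apply: ae_imp (outrate_busy e ff Lu0) => y yP /andP[uy yM].
have [yv|vy] := ltP y Lv; last by rewrite tight_rate// vy.
by rewrite fxo extend_rate_before// yP// uy -(activeP _ _ _ _ _ act).
Qed.

Lemma tight_cumul y z : entry Lu <= y -> y <= z -> z <= Mv ->
  Gout z - Gout y = cumul nu z - cumul nu y.
Proof.
move=> uy yz zM; have y0 := le_trans eLu0 uy.
rewrite -!integB//; last exact: rate_loc_integrable.
apply: ae_eq_integ => //; [exact: rate_loc_integrable|exact: rate_nonneg|].
apply: ae_imp tight_outrate => w wP /andP[yw wz]; apply: wP.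
by rewrite (le_trans uy yw) (lt_le_trans wz zM).
Qed.

Let mid_le xi : xi <= alpha -> Lv + xi * lv <= Mv.
Proof. by move=> xia; rewrite lerD2l ler_wpM2r. Qed.

(** Inflow up to the tail label of the particle equals outflow up to its head label. Hence its queue
    is what capacity serves between [entry t] and the head label. *)
Lemma tight_leave xi : 0 <= xi < alpha ->
  leave N fx e (Lu + xi * lu) = Lv + xi * lv.
Proof.
move=> /andP[xi0 xia]; set t := Lu + xi * lu.
have ut : Lu <= t by rewrite lerDl mulr_ge0.
have uet : entry Lu <= entry t by rewrite entry_leE// (le_trans Lu0).
have tv : entry t <= Lv + xi * lv.
  move: xi0; rewrite le_eqVlt => /predU1P[xi0|xi0].
    by rewrite /t -xi0 !mul0r !addr0; exact: active_entry_le.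
  by apply/ltW/lt_label; rewrite xi0.
apply: leave_eq => //; first exact: le_trans ut.
rewrite ext_in_mid ?xi0 ?(ltW xia)// -ext_out_mid ?xi0 ?(ltW xia)//.
by rewrite (tight_cumul uet tv (mid_le (ltW xia))) subrKC.
Qed.

Lemma tight_busy t : Lu < t -> entry t < Mv -> Gout (entry t) < Gin t.
Proof.
move=> ut etM; have t0 := le_trans Lu0 (ltW ut).
have uet : entry Lu <= entry t by rewrite entry_leE// ltW.
have et0 := entry_ge0 N e t0.
(* By time [z] exactly the flow entered by [t] has left: [z] is the head label of the particle
   entering at [t], or [Mv] once the phase is over. *)
suff [z [zM tz ->]] : exists z, [/\ z <= Mv, entry t < z & Gin t = Gout z].
  rewrite -subr_gt0 (tight_cumul uet (ltW tz) zM) subr_gt0 cumul_ltE//.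
  by rewrite (le_trans et0)// ltW.
have [tM|Mt] := ltP t Mu; last first.
  by exists Mv; split => //; rewrite ext_in_after// ext_out_after.
have [|lup [xi [xi0 xia tE]]] := @affine_param _ Lu lu alpha t lu0.
  by rewrite tM ltW.
have xip : 0 < xi.
  by move: ut; rewrite tE ltrDl pmulr_lgt0.
exists (Lv + xi * lv); split; first exact: mid_le (ltW xia).
  by rewrite tE lt_label ?xip.
by rewrite tE ext_in_mid ?ext_out_mid ?xi0 ?ltW.
Qed.

Let tight_done t : Lu < t -> Mv <= entry t -> Mu <= t.
Proof.
move=> ut Met; rewrite leNgt; apply/negP => tM.
have [|lup [xi [xi0 xia tE]]] := @affine_param _ Lu lu alpha t lu0.
  by rewrite tM ltW.
have xip : 0 < xi.
  by move: ut; rewrite tE ltrDl pmulr_lgt0.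
move: Met; rewrite leNgt tE (lt_le_trans (lt_label _) (mid_le (ltW xia)))//.
by rewrite xip.
Qed.

Lemma tight_queue t : Lu <= t -> Gout (entry t) <= Gin t.
Proof.
rewrite le_eqVlt => /predU1P[<-|ut].
  by rewrite ext_out_entry_before ?ext_in_before// (queue_ge0 e ff).
have [etM|Met] := ltP (entry t) Mv; first by rewrite ltW// tight_busy.
by rewrite ext_out_after ?ext_in_after// tight_done.
Qed.

Lemma tight_dynamics : {ae mu, forall t : R, Lu <= t -> outrate fx e (entry t) =
  if Gout (entry t) < Gin t then nu (entry t)
  else Num.min (inrate fx e t / gam t) (nu (entry t))}.
Proof.
(* The time [Lu] is discarded, since a queue that is about to grow is still empty there. *)
apply: ae_imp (ae_and (outrate_queue e ff) (ae_neq Lu)) => t [dyn tu] ut.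
have {tu}ut : Lu < t by rewrite lt_neqAle ut andbT eq_sym; apply/eqP.
have t0 := le_trans Lu0 (ltW ut); have et0 := entry_ge0 N e t0.
have [etM|Met] := ltP (entry t) Mv.
  rewrite tight_busy//; have [ev|ve] := ltP (entry t) Lv; last first.
    by rewrite tight_rate// ve.
  rewrite fxo extend_rate_before// dyn// (queue_busy ff Lu0 (ltW ut))//.
  by rewrite -(activeP _ _ _ _ _ act).
have Mt := tight_done ut Met.
rewrite ext_out_after// ext_in_after// ltxx fxi fxo !extend_rate_after//.
by rewrite mul0r min_l// ltW// rate_gt0.
Qed.

End Tight.

(* The queue of the arc remains empty during the extension phase. *)
Section Free.
Variable g : R.
Hypothesis entry_Lu : entry Lu = Lv.
Hypothesis gam_const : forall t, Lu <= t < Mu -> gam t = g.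
Hypothesis g0 : 0 < g.
Hypothesis free : x <= nu Lv * (g * lu).
Hypothesis free_lv : 0 < x -> lv = g * lu.

Lemma free_entry xi : 0 <= xi <= alpha ->
  entry (Lu + xi * lu) = Lv + xi * (g * lu).
Proof.
move=> /andP[xi0 xia].
rewrite (@entry_affine _ _ _ _ _ _ (alpha * lu) g)//.
- by rewrite entry_Lu; ring.
- by move=> h /andP[h0 ha]; apply: gam_const; rewrite lerDl h0 ltrD2l.
- by rewrite mulr_ge0// ler_wpM2r.
Qed.

Lemma free_late t : Lu <= t -> Lv <= entry t.
Proof. by move=> ut; rewrite -entry_Lu entry_leE// (le_trans Lu0). Qed.

Lemma free_done t : 0 < x -> Mu <= t -> Mv <= entry t.
Proof.
move=> xp Mt; rewrite (free_lv xp) -(@free_entry alpha)// entry_leE//.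
  exact: le_trans uM.
by apply: le_trans Mt; exact: le_trans uM.
Qed.

(** If flow is sent, [lv = g * lu] makes [entry] map the appended inflow interval onto the outflow
    interval; otherwise both cumulative functions stay constant. *)
Lemma free_queue t : Lu <= t -> Gout (entry t) = Gin t.
Proof.
move=> ut; have lt_ := free_late ut; move: (x0).
rewrite le_eqVlt => /predU1P[/esym xE|xp].
  by rewrite ext_in_idle ?ext_out_idle.
have [tM|Mt] := ltP t Mu; last first.
  by rewrite ext_in_after// ext_out_after// free_done.
have [|lup [xi [xi0 xia ->]]] := @affine_param _ Lu lu alpha t lu0.
  by rewrite tM ut.
have xiI : 0 <= xi <= alpha by rewrite xi0 ltW.
by rewrite free_entry// -(free_lv xp) ext_in_mid ?ext_out_mid.
Qed.

Lemma free_leave xi : 0 <= xi < alpha ->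
  leave N fx e (Lu + xi * lu) = Lv + xi * (g * lu).
Proof.
move=> /andP[xi0 xia]; rewrite -free_entry ?xi0 ?(ltW xia)//.
have ut : Lu <= Lu + xi * lu by rewrite lerDl mulr_ge0.
apply: leave_eq => //; first exact: le_trans ut.
by rewrite free_queue// subrr addr0.
Qed.

Lemma free_dynamics : {ae mu, forall t : R, Lu <= t -> outrate fx e (entry t) =
  if Gout (entry t) < Gin t then nu (entry t)
  else Num.min (inrate fx e t / gam t) (nu (entry t))}.
Proof.
apply: ae_triv => t ut; have t0 := le_trans Lu0 ut; have et0 := entry_ge0 N e t0.
have lt_ := free_late ut; have nue := ltW (rate_gt0 nuP et0).
rewrite free_queue// ltxx; move: (x0).
rewrite le_eqVlt => /predU1P[/esym xE|xp].
  by rewrite ext_inrate_idle ?ext_outrate_idle// mul0r min_l.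
have [tM|Mt] := ltP t Mu; last first.
  by rewrite fxi fxo !extend_rate_after ?free_done// mul0r min_l.
have utM : Lu <= t < Mu by rewrite ut.
have [lup [xi [xi0 xia tE]]] := affine_param lu0 utM; have lvp := x_lv xp.
have evM : Lv <= entry t < Mv.
  rewrite lt_ tE free_entry ?xi0 ?ltW//= -(free_lv xp).
  by rewrite ltrD2l ltr_pM2r.
rewrite fxi fxo !extend_rate_mid// gam_const// (cap_const evM).
(* Crossing an empty arc divides the rate by the speed ratio; by [free] the result is within
   capacity, so it is the minimum. *)
have -> : x / lu / g = x / lv by rewrite (free_lv xp) invfM mulrA mulrAC.
by rewrite min_l// ler_pdivrMr// (free_lv xp).
Qed.

End Free.
End Active.

End ExtendedArc.

(** * The alpha-extension of the whole flow *)

Section AlphaExtension.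
Context {R : realType} {V E : finType} (N : network R V E).
Context (f : flow R E) (l : V -> R -> R) (phi alpha : R).
Context (x' : E -> R) (l' : V -> R).
Local Notation mu := (@lebesgue_measure R).
Hypothesis phi0 : 0 <= phi.
Hypothesis f_nash : restricted_nash N f phi.
Hypothesis la : earliest_arrival N f l.
Hypothesis thin : particle_thin_flow N f l phi x' l'.
Hypothesis alpha_feasible : feasible_alpha N f l phi l' alpha.

Local Notation A := (active_arcs N f l phi).
Local Notation fx := (alpha_extension N f l phi x' l' alpha).
Local Notation x0 e := (if e \in A then x' e else 0).
Local Notation L v := (l v phi).
Local Notation entry := (queue_time N).
Local Notation rhoA := (rho N (resetting_arcs N f l phi)
  (fun e => cap N e (L (head N e))) (fun e => speed_ratio N e (L (tail N e))) l' x').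

Let ff := nash_feasible f_nash.

Let L0 v : 0 <= L v. Proof. exact: label_ge0 la phi0. Qed.

Let cap0 e : e \in A -> 0 < cap N e (L (head N e)).
Proof. by move=> _; apply: rate_gt0 => //; exact: capP. Qed.

Let r0 : 0 < inflow N (L (src N)).
Proof. by apply: rate_gt0 => //; exact: inflowP. Qed.

Let alpha0 : 0 < alpha. Proof. by case: alpha_feasible. Qed.

Let l'0 v : 0 <= l' v. Proof. exact: (thin_label_ge0 thin cap0 r0). Qed.

Section Arc.
Variable e : E.
Local Notation lu := (l' (tail N e)).
Local Notation lv := (l' (head N e)).
Local Notation Lu := (L (tail N e)).
Local Notation Lv := (L (head N e)).

Let xe0 : 0 <= x0 e.
Proof. by case: ifP => // eA; exact: (thin_flow_ge0 thin eA). Qed.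

Let xe_lu : 0 < x0 e -> 0 < lu.
Proof. by case: ifP => [eA|_]; [exact: (thin_label_tail_gt0 thin cap0 r0 eA)|rewrite ltxx]. Qed.

Let xe_lv : 0 < x0 e -> 0 < lv.
Proof. by case: ifP => [eA|_]; [exact: (thin_label_head_gt0 thin cap0 eA)|rewrite ltxx]. Qed.

Let idle_x : e \notin A -> x0 e = 0.
Proof. by move=> /negbTE ->. Qed.

Let idle_late : e \notin A -> forall xi : R, 0 <= xi < alpha ->
  Lv + xi * lv < entry e (Lu + xi * lu).
Proof.
move=> eA xi xiI; have [_ /(_ xi xiI)[_ /(_ e eA) + _ _ _]] := alpha_feasible.
by rewrite queue_timeE ltrBlDl.
Qed.

Let resetting_late : e \in resetting_arcs N f l phi -> forall xi : R,
  0 <= xi < alpha -> entry e (Lu + xi * lu) < Lv + xi * lv.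
Proof.
move=> eA xi xiI; have [_ /(_ xi xiI)[/(_ e eA) + _ _ _ _]] := alpha_feasible.
by rewrite queue_timeE ltrBrDl.
Qed.

Let cap_const : e \in A -> forall y, Lv <= y < Lv + alpha * lv ->
  cap N e y = cap N e Lv.
Proof.
move=> eA y /(affine_param (l'0 _))[_ [xi [xi0 xia ->]]].
have xiI : 0 <= xi < alpha by rewrite xi0.
by have [_ /(_ xi xiI)[_ _ /(_ e eA) <- _ _]] := alpha_feasible.
Qed.

Let gam_const : e \in A -> forall t, Lu <= t < Lu + alpha * lu ->
  speed_ratio N e t = speed_ratio N e Lu.
Proof.
move=> eA t /(affine_param (l'0 _))[_ [xi [xi0 xia ->]]].
have xiI : 0 <= xi < alpha by rewrite xi0.
by have [_ /(_ xi xiI)[_ _ _ _ /(_ e eA) <-]] := alpha_feasible.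
Qed.


Let fxi : inrate fx e =
  extend_rate (inrate f e) Lu (Lu + alpha * lu) (x0 e / lu).
Proof. by []. Qed.

Let fxo : outrate fx e =
  extend_rate (outrate f e) Lv (Lv + alpha * lv) (x0 e / lv).
Proof. by []. Qed.

(* Either the arc is used to capacity during the extension phase, or its queue
   remains empty. *)
Let tight_or_free : e \in A ->
  [/\ x' e = cap N e Lv * lv, rhoA e = lv
    & forall xi : R, 0 < xi < alpha -> entry e (Lu + xi * lu) < Lv + xi * lv] \/
  let g := speed_ratio N e Lu in
  [/\ entry e Lu = Lv, rhoA e = g * lu, x' e <= cap N e Lv * (g * lu)
    & 0 < x' e -> lv = g * lu].
Proof.
move=> eA; have nu0 := cap0 eA; have lvE := thin_label_eq thin eA.
have hs := active_head_neq_src ff la phi0 eA.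
have lv_rho := thin_label_le thin eA hs.
have g0 := speed_ratio_gt0 N e (L0 (tail N e)).
have [eR|eR] := boolP (e \in resetting_arcs N f l phi).
  have rhoE : rhoA e = x' e / cap N e Lv by rewrite /rho eR.
  have rho_lv : rhoA e = lv.
    have := thin_flow_ge0 thin eA; rewrite le_eqVlt => /predU1P[x_0|/lvE//].
    (* Without flow [rho] is 0 on a resetting arc, and [lv] lies between 0 and [rho]. *)
    apply/eqP; rewrite eq_le lv_rho andbT rhoE -x_0 mul0r; exact: l'0.
  left; split => //; first by rewrite -rho_lv rhoE mulrC divfK// gt_eqF.
  by move=> xi /andP[xi0 xia]; apply: resetting_late; rewrite ?xia ?ltW.
have rhoE : rhoA e = Num.max (speed_ratio N e Lu * lu) (x' e / cap N e Lv).
  by rewrite /rho (negbTE eR).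
have entry_Lu : entry e Lu = Lv.
  have q0 := queue_ge0 e ff (L0 (tail N e)).
  rewrite (activeP _ _ _ _ _ eA); apply/eqP.
  rewrite eq_le (le_entry_leave (L0 (tail N e)) q0)/= leNgt.
  rewrite (lt_entry_leave (L0 (tail N e)) q0).
  by rewrite -(resetting_arcsE phi0 f_nash la).
(* On an arc without queue, the maximum in [rho] decides whether the queue stays empty or starts to
   grow. In the latter case flow is positive and [lv] exceeds the slope [g * lu] of [entry]. *)
have [small|large] := leP (x' e / cap N e Lv) (speed_ratio N e Lu * lu).
  have rhoE' : rhoA e = speed_ratio N e Lu * lu by rewrite rhoE; exact: max_l.
  right; split => //; last by move=> /lvE ->.
  by rewrite mulrC -ler_pdivrMr.
have rhoE' : rhoA e = x' e / cap N e Lv by rewrite rhoE max_r// ltW.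
have xp : 0 < x' e.
  have : 0 < x' e / cap N e Lv.
    by apply: le_lt_trans large; rewrite mulr_ge0// ltW.
  by rewrite pmulr_lgt0// invr_gt0.
left; rewrite (lvE xp) rhoE'; split => //.
  by rewrite mulrC divfK// gt_eqF.
move=> xi /andP[xi0 xia].
have gc : forall h, 0 <= h < alpha * lu ->
    speed_ratio N e (Lu + h) = speed_ratio N e Lu.
  by move=> h /andP[h0 ha]; apply: gam_const; rewrite // lerDl h0 ltrD2l.
rewrite (@entry_affine _ _ _ _ _ _ (alpha * lu) _ (L0 _) g0 gc); last first.
  by rewrite mulr_ge0 ?(ltW xi0)//= ler_wpM2r// (ltW xia).
by rewrite entry_Lu ltrD2l mulrCA ltr_pM2l.
Qed.

Let ext_dynamics_after : {ae mu, forall t : R, Lu <= t ->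
  outrate fx e (entry e t) =
  if cumul (outrate fx e) (entry e t) < cumul (inrate fx e) t
  then cap N e (entry e t)
  else Num.min (inrate fx e t / speed_ratio N e t) (cap N e (entry e t))}.
Proof.
have [eA|eA] := boolP (e \in A); last first.
  exact: (idle_dynamics phi0 f_nash la alpha0 (l'0 _) (l'0 _) xe0 xe_lu xe_lv
    fxi fxo idle_x idle_late eA).
have x0E : x0 e = x' e by rewrite eA.
have [[tight _ late]|[entry_Lu _ free lvE]] := tight_or_free eA.
  exact: (tight_dynamics phi0 f_nash la alpha0 (l'0 _) (l'0 _) xe0 xe_lu xe_lv
    fxi fxo eA (cap_const eA) (etrans x0E tight) late).
have g0 := speed_ratio_gt0 N e (L0 (tail N e)).
rewrite -x0E in free lvE.
exact: (free_dynamics phi0 f_nash la alpha0 (l'0 _) (l'0 _) xe0 xe_lu xe_lv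
    fxi fxo (cap_const eA) entry_Lu (gam_const eA) g0 free lvE).
Qed.

Lemma ext_dynamics : {ae mu, forall t : R, 0 <= t ->
  outrate fx e (entry e t) =
  if cumul (outrate fx e) (entry e t) < cumul (inrate fx e) t
  then cap N e (entry e t)
  else Num.min (inrate fx e t / speed_ratio N e t) (cap N e (entry e t))}.
Proof.
have before := dynamics_before phi0 f_nash la alpha0 (l'0 _) (l'0 _) xe0
  xe_lv fxi fxo idle_x.
apply: ae_imp (ae_and before ext_dynamics_after) => t [tb ta] t0.
by have [|] := ltP t Lu; [exact: tb|exact: ta].
Qed.

Lemma ext_queue_ge0 t : 0 <= t ->
  cumul (outrate fx e) (entry e t) <= cumul (inrate fx e) t.
Proof.
move=> t0; have [tu|/ltW tu] := leP t Lu.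
  rewrite (ext_in_before f_nash (l'0 _) xe0 fxi t0 tu).
  rewrite (ext_out_entry_before phi0 f_nash la alpha0 (l'0 _) xe0 xe_lv fxo
    idle_x t0 tu).
  exact: (queue_ge0 e ff).
have [eA|eA] := boolP (e \in A); last first.
  by rewrite (idle_queue phi0 f_nash la alpha0 (l'0 _) (l'0 _) xe0 xe_lu xe_lv
    fxi fxo idle_x idle_late eA).
have x0E : x0 e = x' e by rewrite eA.
have [[tight _ late]|[entry_Lu _ free lvE]] := tight_or_free eA.
  exact: (tight_queue phi0 f_nash la alpha0 (l'0 _) (l'0 _) xe0 xe_lu xe_lv
    fxi fxo idle_x eA (cap_const eA) (etrans x0E tight) late).
have g0 := speed_ratio_gt0 N e (L0 (tail N e)).
rewrite -x0E in free lvE.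
by rewrite (free_queue phi0 f_nash la alpha0 (l'0 _) (l'0 _) xe0 xe_lu xe_lv
    fxi fxo entry_Lu (gam_const eA) g0 lvE).
Qed.

Lemma ext_leave_active xi : e \in A -> 0 <= xi < alpha ->
  leave N fx e (Lu + xi * lu) = Lv + xi * rhoA e.
Proof.
move=> eA xiI; have x0E : x0 e = x' e by rewrite eA.
have [[tight -> late]|[entry_Lu -> free lvE]] := tight_or_free eA.
  exact: (tight_leave phi0 f_nash la (l'0 _) (l'0 _) xe0 xe_lu xe_lv
    fxi fxo eA (cap_const eA) (etrans x0E tight) late).
have g0 := speed_ratio_gt0 N e (L0 (tail N e)).
rewrite -x0E in lvE.
exact: (free_leave phi0 f_nash la alpha0 (l'0 _) (l'0 _) xe0 xe_lu xe_lv
    fxi fxo entry_Lu (gam_const eA) g0 lvE).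
Qed.

Lemma ext_leave_inactive xi : e \notin A -> 0 <= xi < alpha ->
  Lv + xi * lv < leave N fx e (Lu + xi * lu).
Proof.
move=> eA xiI; apply: lt_le_trans (idle_late eA xiI) _.
have u0 : 0 <= Lu + xi * lu.
  by rewrite addr_ge0// mulr_ge0//; case/andP: xiI.
exact: (le_entry_leave u0 (ext_queue_ge0 u0)).
Qed.

Lemma ext_leave_early t : 0 <= t -> t <= Lu -> leave N fx e t = leave N f e t.
Proof.
exact: (ext_leave_before phi0 f_nash la alpha0 (l'0 _) (l'0 _) xe0 xe_lv
  fxi fxo idle_x).
Qed.

Lemma ext_rates :
  [/\ loc_integrable (inrate fx e), loc_integrable (outrate fx e),
      [bounded inrate fx e theta | theta in `[0, +oo[%classic]
    & [bounded outrate fx e theta | theta in `[0, +oo[%classic]].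
Proof.
have ii := inrate_loc_integrable e ff; have io := outrate_loc_integrable e ff.
have pi := inrate_nonneg e ff; have po := outrate_nonneg e ff.
have [[/(_ e)[_ _ bi bo] _ _ _ _] _ _] := ff.
rewrite fxi fxo; split.
- by apply: extend_rate_loc_integrable => //; exact: divr_ge0.
- by apply: extend_rate_loc_integrable => //; exact: divr_ge0.
- by apply: extend_rate_bounded => //; exact: divr_ge0.
- by apply: extend_rate_bounded => //; exact: divr_ge0.
Qed.

Lemma ext_rates_ge0 t : 0 <= t -> 0 <= inrate fx e t /\ 0 <= outrate fx e t.
Proof.
move=> t0; rewrite fxi fxo; split; apply: extend_rate_nonneg => //.
- exact: divr_ge0.
- exact: (inrate_nonneg e ff).
- exact: divr_ge0.
- exact: (outrate_nonneg e ff).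
Qed.

Lemma ext_outrate_early :
  {ae mu, forall y : R, 0 <= y < entry e 0 -> outrate fx e y = 0}.
Proof.
have [_ _ /(_ e) early] := ff.
have e0 : entry e 0 = transit N e 0 by rewrite queue_timeE add0r.
apply: (outrate_early_ext phi0 f_nash la fxo idle_x).
by rewrite e0.
Qed.

End Arc.

Let out v := \sum_(e in A | tail N e == v) x' e.
Let inn v := \sum_(e in A | head N e == v) x' e.

(** All rates at [v] switch at the same times [L v] and [L v + alpha * l' v], so extension commutes
    with the sums and conservation reduces to that of the thin flow. *)
Lemma ext_net_rate v t :
  \sum_(e | tail N e == v) inrate fx e t -
    \sum_(e | head N e == v) outrate fx e t =
  extend_rate (fun t => \sum_(e | tail N e == v) inrate f e t -
      \sum_(e | head N e == v) outrate f e t)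
    (L v) (L v + alpha * l' v) ((out v - inn v) / l' v) t.
Proof.
rewrite /alpha_extension/= /extend_rate mulrBl !mulr_suml.
under eq_bigr => e /eqP -> do [].
under [X in _ - X]eq_bigr => e /eqP -> do [].
case: ifP => // _; case: ifP => _; last by rewrite !big1// subrr.
have mask (p : pred E) : \sum_(e | p e) x0 e / l' v =
    \sum_(e in A | p e) x' e / l' v.
  by rewrite [RHS]big_mkcondl; apply: eq_bigr => e _; case: ifP => // _; rewrite mul0r.
by rewrite !mask.
Qed.

(** The inflow rate is constant in the phase with inverse [l' (src N)]. The endpoint [xi = alpha] is
    included because it locates the new truncation of the inflow. *)
Lemma ext_label_src xi : 0 <= xi <= alpha ->
  ell_src N (phi + xi) = L (src N) + xi * l' (src N).
Proof.
move=> /andP[xi0 xia].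
have ls : l' (src N) = (inflow N (L (src N)))^-1 := thin_label_src thin.
have [_ Is] := ell_src_spec N phi0.
have m0 : 0 <= xi * l' (src N) by rewrite mulr_ge0.
apply: ell_src_eq; first by rewrite addr_ge0.
have -> : cumul (inflow N) (L (src N) + xi * l' (src N)) =
    cumul (inflow N) (L (src N)) +
    integ (inflow N) (L (src N)) (L (src N) + xi * l' (src N)).
  by rewrite integB ?lerDl ?subrKC//; exact/rate_loc_integrable/inflowP.
rewrite (@ae_cst_integ _ _ (inflow N (L (src N))))//.
- rewrite {1}(label_src la phi0) Is (addrC (L (src N))) addrK ls.
  by congr (_ + _); field; rewrite gt_eqF.
- exact/rate_loc_integrable/inflowP.
- exact/rate_nonneg/inflowP.
- exact: ltW.
- by rewrite lerDl.
apply: ae_triv => y /andP[sy ys].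
have /(affine_param (l'0 _))[_ [z [z0 za ->]]] :
    L (src N) <= y < L (src N) + alpha * l' (src N).
  by rewrite sy (lt_le_trans ys)// lerD2l ler_wpM2r.
have zI : 0 <= z < alpha by rewrite z0.
by have [_ /(_ z zI)[_ _ _ <- _]] := alpha_feasible.
Qed.

Lemma ext_feasible : feasible_flow N (truncated_inflow N (phi + alpha)) fx.
Proof.
case: (ff) => -[_ _ _ cons csrc] _ _.
split; last 2 first.
- move=> e; apply: ae_imp (ext_dynamics e) => t dyn t0.
  by rewrite queueE subr_gt0 -queue_timeE dyn.
- move=> e; have := ext_outrate_early e.
  by rewrite queue_timeE add0r.
split.
- exact: ext_rates.
- exact: ext_rates_ge0.
- move=> e t t0; have := ext_queue_ge0 e t0.
  by rewrite queue_timeE [cumul]unlock.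
- move=> v vs vt; apply: ae_imp (cons v vs vt) => t ct t0.
  rewrite ext_net_rate /extend_rate ct//.
  have -> : out v - inn v = 0 by case: thin => -[_ /(_ v vs vt)].
  by rewrite mul0r !if_same.
apply: ae_imp csrc => t ct t0.
rewrite ext_net_rate /extend_rate ct//.
have -> : out (src N) - inn (src N) = 1 by case: thin => -[].
rewrite /truncated_inflow -(label_src la phi0).
rewrite (ext_label_src (xi := alpha)) ?lexx ?andbT ?ltW//.
have [ts|st] := ltP t (L (src N)).
  by rewrite ifT// (lt_le_trans ts)// lerDl mulr_ge0// ltW.
case: ifP => // tM.
have /(affine_param (l'0 _))[_ [z [z0 za ->]]] :
    L (src N) <= t < L (src N) + alpha * l' (src N) by rewrite st tM.
have zI : 0 <= z < alpha by rewrite z0.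
have [_ /(_ z zI)[_ _ _ <- _]] := alpha_feasible.
(* The appended net rate at the source is [1 / l' (src N)], the inflow rate itself. *)
by rewrite (thin_label_src thin) div1r invrK.
Qed.

Lemma alpha_extension_nash : restricted_nash N fx (phi + alpha).
Proof.
split; first exact: ext_feasible.
have [l1 la1] := earliest_arrival_exists ext_feasible.
(* Three kinds of labels are patched: those of [f], the affine ones, and beyond [phi + alpha], where
   only the label equations have to hold, any earliest arrival times of the extension. *)
pose lx v psi := if psi <= phi then l v psi
  else if psi < phi + alpha then L v + (psi - phi) * l' v else l1 v psi.
have lx_before v psi : psi <= phi -> lx v psi = l v psi by rewrite /lx => ->.
have lx_mid v xi : 0 <= xi < alpha -> lx v (phi + xi) = L v + xi * l' v.
  move=> /andP[]; rewrite le_eqVlt => /predU1P[<-|xi0 xia].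
    by rewrite addr0 lx_before// mul0r addr0.
  by rewrite /lx leNgt ltrDl xi0/= ltrD2l xia addrAC subrr add0r.
have lx_leave e psi : 0 <= psi <= phi ->
    leave N fx e (lx (tail N e) psi) = leave N f e (l (tail N e) psi).
  move=> /andP[p0 pphi]; rewrite lx_before// ext_leave_early//.
    exact: label_ge0 la p0.
  exact: (label_le ff _ la la p0 pphi).
exists lx.
  move=> psi p0; have [pphi|phip] := leP psi phi.
    have [ln lsrc lmin] := la p0.
    split => [v||v vs]; rewrite ?lx_before//.
    have -> : [set exit_time N fx e (lx (tail N e) psi) | e in
        [set e | head N e = v]] = [set exit_time N f e (l (tail N e) psi) | e in
        [set e | head N e = v]].
      apply: eq_imagel => e _; have := @lx_leave e psi.
      by rewrite p0 pphi => /(_ isT); rewrite [leave]unlock.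
    exact: lmin.
  have [pa|ap] := ltP psi (phi + alpha); last first.
    have lxE v : lx v psi = l1 v psi by rewrite /lx !ifF//; apply/negbTE; rewrite -?ltNge -?leNgt.
    have [ln lsrc lmin] := la1 psi p0.
    split => [v||v vs]; rewrite ?lxE//.
    by under eq_imagel => e _ do rewrite lxE; exact: lmin.
  have [xi [xi0 xia ->]] : exists xi, [/\ 0 <= xi, xi < alpha & psi = phi + xi].
    by exists (psi - phi); split; [rewrite subr_ge0 ltW|rewrite ltrBlDl|ring].
  have xiI : 0 <= xi < alpha by rewrite xi0.
  split => [v||v vs]; rewrite lx_mid//.
  - by rewrite addr_ge0// mulr_ge0.
  - by rewrite ext_label_src// xi0 ltW.
  split.
    have [e [eA eh lE]] := thin_label_attained thin vs.
    exists e => //; rewrite lx_mid// -[LHS]/(exit_time N fx e _).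
    have := ext_leave_active eA xiI; rewrite [leave]unlock => ->.
    by rewrite eh lE.
  move=> _ [e eh <-]; rewrite lx_mid//.
  have -> : exit_time N fx e = leave N fx e by rewrite unlock.
  rewrite -{1 2}eh; have [eA|eA] := boolP (e \in A); last first.
    by rewrite ltW// ext_leave_inactive.
  rewrite ext_leave_active// lerD2l ler_wpM2l//.
  by apply: (thin_label_le thin eA); rewrite eh.
move=> e; apply: ae_imp (nash_active f_nash la e) => t tP t0 fxt.
have [tu|ut] := ltP t (L (tail N e)).
  have : 0 < inrate f e t by move: fxt; rewrite /= extend_rate_before.
  move=> /(tP t0)[psi [p0 pphi eA lE]]; have pI : 0 <= psi <= phi by rewrite p0.
  exists psi; last by rewrite lx_before.
  split; first by rewrite p0 (le_trans pphi)// lerDl ltW.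
  apply/activeP; rewrite lx_leave// lx_before//; exact/activeP.
have [tM|Mt] := ltP t (L (tail N e) + alpha * l' (tail N e)); last first.
  by move: fxt; rewrite /= extend_rate_after ?ltxx// lerDl mulr_ge0// ltW.
have tI : L (tail N e) <= t < L (tail N e) + alpha * l' (tail N e) by rewrite ut.
have [lup [xi [xi0 xia tE]]] := affine_param (l'0 _) tI.
have xiI : 0 <= xi < alpha by rewrite xi0.
(* A positive appended rate means [x' e > 0] on an active arc, where the thin flow turns the label
   inequality into an equality; so the arc is active for [phi + xi]. *)
have {fxt} /andP[eA xp] : (e \in A) && (0 < x' e).
  move: fxt; rewrite /= extend_rate_mid// pmulr_lgt0 ?invr_gt0//.
  by case: ifP => // _; rewrite ltxx.
exists (phi + xi); last by rewrite lx_mid.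
split; first by rewrite addr_ge0//= lerD2l ltW.
by apply/activeP; rewrite !lx_mid// ext_leave_active// (thin_label_eq thin eA xp).
Qed.

End AlphaExtension.

Unset Implicit Arguments.

Theorem theorem3 (R : realType) (V E : finType) (N : network R V E)
    (f : flow R E) (l : V -> R -> R) (phi alpha : R)
    (x' : E -> R) (l' : V -> R)
    (phi_ge0 : 0 <= phi)
    (f_nash : restricted_nash N f phi)
    (l_arrival : earliest_arrival N f l)
    (thin : particle_thin_flow N f l phi x' l')
    (alpha_feasible : feasible_alpha N f l phi l' alpha) :
  restricted_nash N (alpha_extension N f l phi x' l' alpha) (phi + alpha).
Proof. exact: alpha_extension_nash. Qed.
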